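(* Let $X, Y, W(S_1), P, Z, U$ be the graphs, with the corresponding maps $\alpha_X, \alpha_Y, \beta_X, \beta_Y, \gamma, \delta$, associated with finitely generated subgroups $H,K$ of $F=\pi_1(U)$ and a nonempty $S_1\subseteq S(H,K)$ as described in the context. Then there exists a finite sequence $\tau$ of alternating replacements and admissible elementary deformations (both defined in the context) that results in graphs $X^\tau, Y^\tau, W(S_1)^\tau, P^\tau, Z^\tau, U^\tau$ with the following properties: $\bar{\mathrm r}(X^\tau) = \bar{\mathrm r}(X)$, $\bar{\mathrm r}(Y^\tau) = \bar{\mathrm r}(Y)$, $\bar{\mathrm r}(W(S_1)^\tau) = \bar{\mathrm r}(W(S_1))$, $P^\tau = Z^\tau = U^\tau$, $\bar{\mathrm r}(P^\tau) \ge \bar{\mathrm r}(P)$, every vertex of $U^\tau$ has degree $3$ or $2$, and every vertex of degree $3$ of $U^\tau$ has a preimage of degree $3$ in $X^\tau$ or $Y^\tau$.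
   Context: Graphs. For a finite graph $\Gamma$ with vertex set $V\Gamma$ and set of nonoriented edges $E\Gamma$ put $\bar{\mathrm r}(\Gamma) := |E\Gamma| - |V\Gamma|$. $\mathrm{core}(\Gamma)$ is the subgraph consisting of all edges lying on circuits (cyclically reduced closed paths of positive length) of $\Gamma$, together with their endpoints. For an oriented edge $e$, $e_-$ and $e_+$ are its initial and terminal vertices. Setting. $U$ is a finite connected graph without vertices of degree 1, $F=\pi_1(U)$ is free; $H,K$ are finitely generated subgroups of $F$. $X$ and $Y$ are the (core) Stallings graphs of $H$ and $K$: the cores of the coverings of $U$ corresponding to $H$, $K$, with the induced locally injective maps $\varphi_X:X\to U$, $\varphi_Y:Y\to U$; so $\mathrm{core}(X)=X$, $\mathrm{core}(Y)=Y$. $S(H,K)$ is a set of representatives of the double cosets $HtK$, $t\in F$, with $H\cap tKt^{-1}\ne\{1\}$. Connected components $W_t$ of $\mathrm{core}(X\times_U Y)$, where $X\times_U Y$ is the pullback of $\varphi_X,\varphi_Y$, correspond bijectively to $t\in S(H,K)$. For nonempty $S_1\subseteq S(H,K)$, $W(S_1)$ is the disjoint union of the $W_s$, $s\in S_1$; $\alpha_X:W(S_1)\to X$, $\alpha_Y:W(S_1)\to Y$ are the restrictions of the pullback projections; $P=X\vee_{W(S_1)}Y$ is the pushout of $\alpha_X,\alpha_Y$ with pushout maps $\beta_X:X\to P$, $\beta_Y:Y\to P$. $Z$ is the Stallings graph of $\langle H,K,S_1\rangle$, and $\gamma:P\to Z$, $\delta:Z\to U$ are the natural graph maps, with $\delta\gamma\beta_X=\varphi_X$,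 $\delta\gamma\beta_Y=\varphi_Y$. ''Preimage'' of a vertex refers to $\beta_X,\beta_Y$ (composed with $\gamma$, $\delta$). Replacement. Keep $X,Y,W(S_1),P,\alpha_X,\alpha_Y,\beta_X,\beta_Y$; replace both $Z$ and $U$ by $P$, $\gamma,\delta$ by identity maps, and $\varphi_X,\varphi_Y$ by $\beta_X,\beta_Y$. ($W(S_1)$ is then a union of connected components of $\mathrm{core}(X\times_P Y)$.) After a replacement $P=Z=U$ holds. Elementary deformation around $v\in VU$ by means of a tree $T$. Subdivide edges incident to $v$ (and correspondingly their preimages in the other graphs) so that the oriented edges $e$ with $e_+=v$ have pairwise distinct initial vertices $e_-$ of degree 2; these edges form a star $\mathrm{St}(v)$ with center $v$ and $\deg v$ rays. Let $T$ be a finite tree whose degree-1 vertices are in bijection with those of $\mathrm{St}(v)$. $U_T$ is obtained from $U$ by removing $\mathrm{St}(v)$ and gluing in $T$ along this bijection. Lift this to $Q\in\{X,Y,W(S_1),Z\}$: for each vertex $u$ of $Q$ mapped to $v$, the star around $u$ is replaced by a copy of the minimal subtree of $T$ containing the degree-1 vertices of $T$ corresponding to the images in $\mathrm{St}(v)$ of the edges at $u$. This yields $X_T,Y_T,W(S_1)_T,Z_T$ with induced maps, the new pushout $P_T=X_T\vee_{W(S_1)_T}Y_T$, and maps $\gamma_T:P_T\to Z_T$, $\delta_T:Z_T\to U_T$. Admissible elementary deformation. It is performed when $P=Z=U$, around a vertex $v_0$ of $U$ of degree at least $4$, by means of a trivalent tree $T$ (every vertex of $T$ has degree 1 or 3),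 such that either $\bar{\mathrm r}(P_T)>\bar{\mathrm r}(P)$, or: $\bar{\mathrm r}(P_T)=\bar{\mathrm r}(P)$, the subgraph $\gamma_T^{-1}\delta_T^{-1}(T)$ of $P_T$ is a tree, and $\sum_{v\in VP_T}\max(\deg v-3,0)<\sum_{v\in VP}\max(\deg v-3,0)$. The graphs with subscript $T$ then become the new $X,Y,W(S_1),P,Z,U$. *)

(* Defs.v *)
From HB Require Import structures.
From Stdlib Require List.
From mathcomp Require Import all_boot all_order all_algebra.
From mathcomp Require Import boolp.

Set Implicit Arguments.
Unset Strict Implicit.
Unset Printing Implicit Defensive.

(* Graphs are graphs in the sense of Serre: [edge] is the type of oriented    *)
(* edges, [einv] reverses the orientation, and a nonoriented edge is a pair   *)
(* {e, einv e}. Loops and multiple edges are allowed. The vertex and edge     *)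
(* types are arbitrary because coverings may be infinite.                     *)
Record graph := Graph {
  vert : Type;
  edge : Type;
  src : edge -> vert;
  einv : edge -> edge;
  einvK : involutive einv;
  einv_neq : forall e, einv e <> e }.

Definition tgt (G : graph) (e : edge G) : vert G := src (einv e).

Record finGraph := FinGraph {
  fvert : finType;
  fedge : finType;
  fsrc : fedge -> fvert;
  finv : fedge -> fedge;
  finvK : involutive finv;
  finv_neq : forall e, finv e <> e }.

Coercion graph_of (G : finGraph) : graph :=
  @Graph (fvert G) (fedge G) (@fsrc G) (@finv G) (@finvK G) (@finv_neq G).

(* A loop counts twice. *)
Definition deg (G : finGraph) (v : fvert G) : nat :=
  #|[set e : fedge G | fsrc e == v]|.

(* [fedge G] consists of oriented edges, hence the half. *)
Definition rbar (G : finGraph) : int :=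
  ((#|fedge G| ./2)%:Z - #|fvert G|%:Z)%R.

Record hom (G G' : graph) := Hom {
  hv : vert G -> vert G';
  he : edge G -> edge G';
  hom_src : forall e, src (he e) = hv (src e);
  hom_inv : forall e, einv (he e) = he (einv e) }.

Definition homeq (G G' : graph) (f g : hom G G') : Prop :=
  hv f =1 hv g /\ he f =1 he g.

Definition hid (G : graph) : hom G G :=
  @Hom G G id id (fun=> erefl) (fun=> erefl).

Lemma hcomp_src (G1 G2 G3 : graph) (g : hom G2 G3) (f : hom G1 G2) e :
  src (he g (he f e)) = hv g (hv f (src e)).
Proof. by rewrite !hom_src. Qed.

Lemma hcomp_inv (G1 G2 G3 : graph) (g : hom G2 G3) (f : hom G1 G2) e :
  einv (he g (he f e)) = he g (he f (einv e)).
Proof. by rewrite !hom_inv. Qed.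

Definition hcomp (G1 G2 G3 : graph) (g : hom G2 G3) (f : hom G1 G2) :
    hom G1 G3 :=
  @Hom G1 G3 (fun v => hv g (hv f v)) (fun e => he g (he f e))
    (hcomp_src g f) (hcomp_inv g f).

Definition is_iso (G G' : graph) (f : hom G G') : Prop :=
  bijective (hv f) /\ bijective (he f).

Definition embedding (G G' : graph) (f : hom G G') : Prop :=
  injective (hv f) /\ injective (he f).

Section Walks.
Variable G : graph.
Implicit Types (u v : vert G) (e : edge G) (p q : seq (edge G)).

Fixpoint walk u p v : Prop :=
  if p is e :: p' then src e = u /\ walk (tgt e) p' v else u = v.

Definition rev_walk p : seq (edge G) := rev (map (@einv G) p).

Fixpoint reduced p : Prop :=
  match p with
  | e :: ((e' :: _) as p') => e' <> einv e /\ reduced p'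
  | _ => True
  end.

Definition circuit p : Prop :=
  (exists v, walk v p v) /\ reduced p /\
  (if p is e :: p' then e <> einv (last e p') else False).

Definition core_edge e : Prop := exists p, circuit p /\ List.In e p.

Definition core_vert v : Prop := exists e, core_edge e /\ (src e = v \/ tgt e = v).

(* A subgraph is given by a predicate A on vertices and B on edges. *)
Definition is_subgraph (A : vert G -> Prop) (B : edge G -> Prop) : Prop :=
  forall e, B e -> A (src e) /\ B (einv e).

Definition connected_subgraph (A : vert G -> Prop) (B : edge G -> Prop) : Prop :=
  is_subgraph A B /\
  forall u v, A u -> A v ->
    exists p, walk u p v /\ forall e, List.In e p -> B e.

Definition tree_subgraph (A : vert G -> Prop) (B : edge G -> Prop) : Prop :=
  (exists v, A v) /\ connected_subgraph A B /\
  ~ exists p, circuit p /\ forall e, List.In e p -> B e.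

Definition connected : Prop :=
  connected_subgraph (fun=> True) (fun=> True).

Definition is_tree : Prop := tree_subgraph (fun=> True) (fun=> True).

(* The intersection of all connected subgraphs containing the vertices in L;  *)
(* in a tree, this is the minimal subtree containing L.                       *)
Definition hull_vert (L : vert G -> Prop) v : Prop :=
  forall A B, connected_subgraph A B -> (forall u, L u -> A u) -> A v.

Definition hull_edge (L : vert G -> Prop) e : Prop :=
  forall A B, connected_subgraph A B -> (forall u, L u -> A u) -> B e.

(* Homotopy of walks from u to v, relative to the endpoints. *)
Inductive htpy u v : seq (edge G) -> seq (edge G) -> Prop :=
| htpy_refl p : walk u p v -> htpy u v p p
| htpy_sym p q : htpy u v p q -> htpy u v q p
| htpy_trans p q r : htpy u v p q -> htpy u v q r -> htpy u v p r
| htpy_backtrack p e q : walk u (p ++ q) v ->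
    walk u (p ++ e :: einv e :: q) v ->
    htpy u v (p ++ q) (p ++ e :: einv e :: q).

(* Elements of pi_1(G, u) are represented by closed walks at u up to [htpy];  *)
(* subsets of pi_1(G, u) are predicates on such walks, and subgroups are the  *)
(* predicates satisfying [subgroup u].                                        *)
Record subgroup u (H : seq (edge G) -> Prop) : Prop := Subgroup {
  subgroup_walk : forall p, H p -> walk u p u;
  subgroup_htpy : forall p q, H p -> htpy u u p q -> H q;
  subgroup1 : H [::];
  subgroupM : forall p q, H p -> H q -> H (p ++ q);
  subgroupV : forall p, H p -> H (rev_walk p) }.

Definition generated u (A : seq (edge G) -> Prop) p : Prop :=
  forall H, subgroup u H -> (forall q, A q -> H q) -> H p.

Definition fg_subgroup u (H : seq (edge G) -> Prop) : Prop :=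
  subgroup u H /\
  exists gens : seq (seq (edge G)),
    (forall q, List.In q gens -> H q) /\
    (forall p, H p -> generated u (fun q => List.In q gens) p).

(* s lies in the double coset H t K *)
Definition in_dcoset u (H K : seq (edge G) -> Prop) t s : Prop :=
  exists h k, H h /\ K k /\ htpy u u s (h ++ t ++ k).

(* H meets t K t^-1 nontrivially *)
Definition nontrivial_meet u (H K : seq (edge G) -> Prop) t : Prop :=
  exists p, H p /\ K (rev_walk t ++ p ++ t) /\ ~ htpy u u p [::].

(* S is a set of representatives of the double cosets H t K that satisfy      *)
(* [nontrivial_meet u H K t].                                                 *)
Definition dcoset_reps u (H K S : seq (edge G) -> Prop) : Prop :=
  (forall t, S t -> walk u t u /\ nontrivial_meet u H K t) /\
  (forall t, walk u t u -> nontrivial_meet u H K t ->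
     exists s, S s /\ in_dcoset u H K s t) /\
  (forall s s', S s -> S s' -> in_dcoset u H K s s' -> htpy u u s s').

End Walks.

(* The (connected, pointed) covering of U corresponding to H <= pi_1(U, u0).  *)
Record covering (U : graph) (u0 : vert U) (H : seq (edge U) -> Prop) :=
  Covering {
  cov_graph : graph;
  cov_base : vert cov_graph;
  cov_map : hom cov_graph U;
  cov_connected : connected cov_graph;
  cov_base_map : hv cov_map cov_base = u0;
  cov_local : forall v e, src e = hv cov_map v ->
    exists! e', src e' = v /\ he cov_map e' = e;
  cov_pi1 : forall p, H p <->
    exists q, walk cov_base q cov_base /\ htpy u0 u0 (map (he cov_map) q) p }.

Definition onto_core (G G' : graph) (f : hom G G') : Prop :=
  embedding f /\
  (forall v, core_vert v <-> exists x, hv f x = v) /\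
  (forall e, core_edge e <-> exists x, he f x = e).

Section Pullback.
Variables (X Y U : finGraph) (f : hom X U) (g : hom Y U).

Definition pb_vert : finType :=
  {z : fvert X * fvert Y | (hv f z.1 : fvert U) == hv g z.2}.
Definition pb_edge : finType :=
  {z : fedge X * fedge Y | (he f z.1 : fedge U) == he g z.2}.

Lemma pb_src_subproof (z : pb_edge) :
  (hv f (fsrc (val z).1) : fvert U) == hv g (fsrc (val z).2).
Proof.
case: z => -[a b] /= /eqP ab; apply/eqP.
by rewrite -(hom_src f a) -(hom_src g b) ab.
Qed.

Lemma pb_inv_subproof (z : pb_edge) :
  (he f (finv (val z).1) : fedge U) == he g (finv (val z).2).
Proof.
case: z => -[a b] /= /eqP ab; apply/eqP.
by rewrite -(hom_inv f a) -(hom_inv g b) ab.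
Qed.

Definition pb_src (z : pb_edge) : pb_vert :=
  Sub (fsrc (val z).1, fsrc (val z).2) (pb_src_subproof z).
Definition pb_inv (z : pb_edge) : pb_edge :=
  Sub (finv (val z).1, finv (val z).2) (pb_inv_subproof z).

Lemma pb_invK : involutive pb_inv.
Proof. by move=> [[a b] ab]; apply: val_inj; rewrite /= !finvK. Qed.

Lemma pb_inv_neq z : pb_inv z <> z.
Proof. by case: z => -[a b] ab /(congr1 val) [/finv_neq]. Qed.

Definition pullback : finGraph := FinGraph pb_src pb_invK pb_inv_neq.

Definition pb_fst : hom pullback X :=
  @Hom pullback X (fun z => (val z).1) (fun z => (val z).1)
    (fun=> erefl) (fun=> erefl).
Definition pb_snd : hom pullback Y :=
  @Hom pullback Y (fun z => (val z).2) (fun z => (val z).2)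
    (fun=> erefl) (fun=> erefl).
End Pullback.

Definition is_pushout (W X Y P : graph) (a : hom W X) (b : hom W Y)
    (a' : hom X P) (b' : hom Y P) : Prop :=
  homeq (hcomp a' a) (hcomp b' b) /\
  forall (G : graph) (f : hom X G) (g : hom Y G),
    homeq (hcomp f a) (hcomp g b) ->
    exists k : hom P G,
      (homeq (hcomp k a') f /\ homeq (hcomp k b') g) /\
      forall k' : hom P G,
        homeq (hcomp k' a') f -> homeq (hcomp k' b') g -> homeq k' k.

(* The graphs X, Y, W(S1), P, Z, U and the maps alpha_X, alpha_Y, beta_X,     *)
(* beta_Y, gamma, delta.                                                      *)
Record config := Config {
  cX : finGraph; cY : finGraph; cW : finGraph;
  cP : finGraph; cZ : finGraph; cU : finGraph;
  alphaX : hom cW cX; alphaY : hom cW cY;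
  betaX : hom cX cP; betaY : hom cY cP;
  gam : hom cP cZ; del : hom cZ cU }.

Definition phiP (c : config) : hom (cP c) (cU c) := hcomp (del c) (gam c).
Definition phiX (c : config) : hom (cX c) (cU c) := hcomp (phiP c) (betaX c).
Definition phiY (c : config) : hom (cY c) (cU c) := hcomp (phiP c) (betaY c).
(* Equal to phiY c o alphaY c, by the pushout square. *)
Definition phiW (c : config) : hom (cW c) (cU c) := hcomp (phiX c) (alphaX c).

(* The vertex z = (x, y) of the pullback of X and Y is labelled by the double *)
(* coset H (p q^-1) K, where p and q are the projections to U of walks from   *)
(* the base points of the two coverings to x and y; [dcoset_label z t] says   *)
(* that it is H t K. The label does not depend on the choice of the walks and *)
(* is constant on connected components; W_t is the component of the core of   *)
(* the pullback labelled H t K.                                               *)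
Definition dcoset_label (U X Y : finGraph) (u0 : fvert U)
    (H K : seq (fedge U) -> Prop) (CH : @covering U u0 H) (CK : @covering U u0 K)
    (iX : hom X (cov_graph CH)) (iY : hom Y (cov_graph CK))
    (f : hom X U) (g : hom Y U) (z : fvert (pullback f g))
    (t : seq (fedge U)) : Prop :=
  exists p q,
    walk (cov_base CH) p (hv iX (val z).1) /\
    walk (cov_base CK) q (hv iY (val z).2) /\
    @in_dcoset U u0 H K t
      (map (he (cov_map CH)) p ++ @rev_walk U (map (he (cov_map CK)) q)).

(* c consists of the graphs and maps associated with the subgroups H and K of *)
(* F = pi_1(U, u0) and the set S1 of double coset representatives.            *)
Record associated (c : config) (u0 : fvert (cU c))
    (H K S1 : seq (fedge (cU c)) -> Prop) := Associated {
  covH : @covering (cU c) u0 H;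
  covK : @covering (cU c) u0 K;
  covL : @covering (cU c) u0
           (@generated (cU c) u0 (fun p => H p \/ K p \/ S1 p));
  (* X, Y, Z are the Stallings graphs of H, K, <H, K, S1>. *)
  incX : hom (cX c) (cov_graph covH);
  incY : hom (cY c) (cov_graph covK);
  incZ : hom (cZ c) (cov_graph covL);
  incX_core : onto_core incX;
  incY_core : onto_core incY;
  incZ_core : onto_core incZ;
  phiX_cov : homeq (phiX c) (hcomp (cov_map covH) incX);
  phiY_cov : homeq (phiY c) (hcomp (cov_map covK) incY);
  del_cov : homeq (del c) (hcomp (cov_map covL) incZ);
  (* W(S1) is the union of the W_t, t in S1. *)
  incW : hom (cW c) (pullback (phiX c) (phiY c));
  incW_emb : embedding incW;
  incW_vert : forall z : fvert (pullback (phiX c) (phiY c)),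
    (exists w, hv incW w = z) <->
    (@core_vert (pullback (phiX c) (phiY c)) z /\
     exists t, S1 t /\ dcoset_label incX incY z t);
  incW_edge : forall z : fedge (pullback (phiX c) (phiY c)),
    (exists w, he incW w = z) <->
    (@core_edge (pullback (phiX c) (phiY c)) z /\
     exists t, S1 t /\ dcoset_label incX incY (fsrc z) t);
  alphaX_pb : homeq (alphaX c) (hcomp (pb_fst (phiX c) (phiY c)) incW);
  alphaY_pb : homeq (alphaY c) (hcomp (pb_snd (phiX c) (phiY c)) incW);
  P_pushout : is_pushout (alphaX c) (alphaY c) (betaX c) (betaY c);
  (* gamma is induced by the base point preserving maps of coverings. *)
  covHL : hom (cov_graph covH) (cov_graph covL);
  covKL : hom (cov_graph covK) (cov_graph covL);
  covHL_base : hv covHL (cov_base covH) = cov_base covL;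
  covKL_base : hv covKL (cov_base covK) = cov_base covL;
  covHL_map : homeq (hcomp (cov_map covL) covHL) (cov_map covH);
  covKL_map : homeq (hcomp (cov_map covL) covKL) (cov_map covK);
  gam_natX : homeq (hcomp incZ (hcomp (gam c) (betaX c))) (hcomp covHL incX);
  gam_natY : homeq (hcomp incZ (hcomp (gam c) (betaY c))) (hcomp covKL incY) }.

Arguments associated : clear implicits.

Definition PZU (c : config) : Prop := is_iso (gam c) /\ is_iso (del c).

Definition replacement (c : config) : config :=
  Config (alphaX c) (alphaY c) (betaX c) (betaY c) (hid (cP c)) (hid (cP c)).

(* The rays of the star of v are indexed by the oriented edges issuing from v *)
(* (so a loop at v gives two rays); [leaf] restricts to a bijection from them *)
(* to the degree-1 vertices of the tree.                                      *)
Record star_tree (U : finGraph) (v : fvert U) := StarTree {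
  stree : finGraph;
  stree_tree : is_tree stree;
  leaf : fedge U -> fvert stree;
  leaf_deg : forall a, fsrc a = v -> deg (leaf a) = 1;
  leaf_inj : forall a b, fsrc a = v -> fsrc b = v -> leaf a = leaf b -> a = b;
  leaf_onto : forall t, deg t = 1 -> exists a, fsrc a = v /\ leaf a = t }.

Section Deformation.
Variables (U : finGraph) (v0 : fvert U) (D : star_tree v0).
Notation T := (stree D).

(* U_T. Every oriented edge a from v0 is subdivided once near v0; the new     *)
(* vertex becomes the leaf [leaf D a] of T, and the part of a that remains    *)
(* after removing the star of v0 is again denoted by a. Hence the vertices of *)
(* U_T are those of U other than v0 and those of T, its edges are those of U  *)
(* and those of T, and an edge a of U starting at v0 now starts at leaf D a.  *)
Definition UT_vert_ok (z : fvert U + fvert T) : bool :=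
  if z is inl u then u != v0 else true.
Definition UT_vert : finType := {z | UT_vert_ok z}.
Definition UT_edge : finType := (fedge U + fedge T)%type.

Definition UT_src_val (e : UT_edge) : fvert U + fvert T :=
  match e with
  | inl a => if fsrc a == v0 then inr (leaf D a) else inl (fsrc a)
  | inr b => inr (fsrc b)
  end.

Lemma UT_src_subproof e : UT_vert_ok (UT_src_val e).
Proof. by case: e => [a|b] //=; case: ifP => //= ->. Qed.

Definition UT_src (e : UT_edge) : UT_vert := Sub (UT_src_val e) (UT_src_subproof e).

Definition UT_inv (e : UT_edge) : UT_edge :=
  match e with inl a => inl (finv a) | inr b => inr (finv b) end.

Lemma UT_invK : involutive UT_inv.
Proof. by case=> a /=; rewrite finvK. Qed.

Lemma UT_inv_neq e : UT_inv e <> e.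
Proof. by case: e => a /= [] /finv_neq. Qed.

Definition UT : finGraph := FinGraph UT_src UT_invK UT_inv_neq.

(* Q_T for a graph Q over U. The copy of the minimal subtree of T glued in at *)
(* a vertex u over v0 has the vertices inr (u, t) and the edges inr (u, b);   *)
(* it is spanned by the leaves corresponding to the edges of Q from u.        *)
Section Lift.
Variables (Q : finGraph) (f : hom Q U).

Definition star_leaf (u : fvert Q) (t : fvert T) : Prop :=
  exists a : fedge Q, fsrc a = u /\ leaf D (he f a) = t.

Definition QT_vert_ok (z : fvert Q + fvert Q * fvert T) : bool :=
  match z with
  | inl u => (hv f u : fvert U) != v0
  | inr (u, t) => ((hv f u : fvert U) == v0) && `[< @hull_vert T (star_leaf u) t >]
  end.
Definition QT_edge_ok (z : fedge Q + fvert Q * fedge T) : bool :=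
  match z with
  | inl _ => true
  | inr (u, b) => ((hv f u : fvert U) == v0) && `[< @hull_edge T (star_leaf u) b >]
  end.

Definition QT_vert : finType := {z | QT_vert_ok z}.
Definition QT_edge : finType := {z | QT_edge_ok z}.

Definition QT_src_val (z : fedge Q + fvert Q * fedge T) :
    fvert Q + fvert Q * fvert T :=
  match z with
  | inl a => if (hv f (fsrc a) : fvert U) == v0
             then inr (fsrc a, leaf D (he f a)) else inl (fsrc a)
  | inr (u, b) => inr (u, fsrc b)
  end.
Definition QT_inv_val (z : fedge Q + fvert Q * fedge T) :
    fedge Q + fvert Q * fedge T :=
  match z with inl a => inl (finv a) | inr (u, b) => inr (u, finv b) end.

Lemma QT_src_subproof (z : QT_edge) : QT_vert_ok (QT_src_val (val z)).
Proof.
case: z => -[a _|[u b]] /=; last first.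
  case/andP=> -> /asboolP hb; apply/asboolP => A B AB LA.
  by have [/(_ _ (hb A B AB LA)) []] := AB.
case: ifP => [h|/negbT //] /=; rewrite h /=.
by apply/asboolP => A B _; apply; exists a.
Qed.

Lemma QT_inv_subproof (z : QT_edge) : QT_edge_ok (QT_inv_val (val z)).
Proof.
case: z => -[a _|[u b]] //= /andP [-> /asboolP hb].
apply/asboolP => A B AB LA.
by have [/(_ _ (hb A B AB LA)) []] := AB.
Qed.

Definition QT_src (z : QT_edge) : QT_vert :=
  Sub (QT_src_val (val z)) (QT_src_subproof z).
Definition QT_inv (z : QT_edge) : QT_edge :=
  Sub (QT_inv_val (val z)) (QT_inv_subproof z).

Lemma QT_invK : involutive QT_inv.
Proof. by move=> [[a|[u b]] h]; apply: val_inj; rewrite /= finvK. Qed.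

Lemma QT_inv_neq z : QT_inv z <> z.
Proof.
by case: z => -[a|[u b]] h /(congr1 val) /= [] /finv_neq.
Qed.

Definition QT : finGraph := FinGraph QT_src QT_invK QT_inv_neq.

(* g is the induced map Q_T -> U_T. *)
Definition induced_to_UT (g : hom QT UT) : Prop :=
  (forall z : fvert QT, val (hv g z : fvert UT) =
     match val z with inl u => inl (hv f u) | inr (_, t) => inr t end) /\
  (forall z : fedge QT, he g z =
     match val z with inl a => inl (he f a) | inr (_, b) => inr b end).

End Lift.

(* gT : Q_T -> Q'_T is induced by the map g : Q -> Q' of graphs over U. *)
Definition induced (Q Q' : finGraph) (f : hom Q U) (f' : hom Q' U)
    (g : hom Q Q') (gT : hom (QT f) (QT f')) : Prop :=
  (forall z : fvert (QT f), val (hv gT z : fvert (QT f')) =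
     match val z with inl u => inl (hv g u) | inr (u, t) => inr (hv g u, t) end) /\
  (forall z : fedge (QT f), val (he gT z : fedge (QT f')) =
     match val z with inl a => inl (he g a) | inr (u, b) => inr (hv g u, b) end).

End Deformation.

(* An elementary deformation around v0; the pushout P_T is determined only up *)
(* to isomorphism.                                                            *)
Record deformation (c : config) (v0 : fvert (cU c)) (D : star_tree v0) :=
  MkDeformation {
  dP : finGraph;
  d_alphaX : hom (QT D (phiW c)) (QT D (phiX c));
  d_alphaY : hom (QT D (phiW c)) (QT D (phiY c));
  d_betaX : hom (QT D (phiX c)) dP;
  d_betaY : hom (QT D (phiY c)) dP;
  d_gam : hom dP (QT D (del c));
  d_del : hom (QT D (del c)) (UT D);
  d_alphaX_ind : induced (alphaX c) d_alphaX;
  d_alphaY_ind : induced (alphaY c) d_alphaY;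
  d_pushout : is_pushout d_alphaX d_alphaY d_betaX d_betaY;
  d_gamX_ind : induced (hcomp (gam c) (betaX c)) (hcomp d_gam d_betaX);
  d_gamY_ind : induced (hcomp (gam c) (betaY c)) (hcomp d_gam d_betaY);
  d_del_ind : induced_to_UT d_del }.

Section DeformedConfig.
Variables (c : config) (v0 : fvert (cU c)) (D : star_tree v0).
Variable d : deformation D.

Definition deformed : config :=
  Config (d_alphaX d) (d_alphaY d) (d_betaX d) (d_betaY d) (d_gam d) (d_del d).

(* The subgraph of P_T that is the preimage of T. *)
Definition over_tree_vert (x : fvert (dP d)) : Prop :=
  exists t, val (hv (d_del d) (hv (d_gam d) x) : fvert (UT D)) = inr t.
Definition over_tree_edge (e : fedge (dP d)) : Prop :=
  exists b, he (d_del d) (he (d_gam d) e) = inr b :> fedge (UT D).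
End DeformedConfig.

Definition excess (G : finGraph) : nat := \sum_(v : fvert G) (deg v - 3).

Definition admissible_deformation (c c' : config) : Prop :=
  PZU c /\
  exists (v0 : fvert (cU c)) (D : star_tree v0) (d : deformation D),
    [/\ c' = deformed d,
        4 <= deg v0,
        forall t : fvert (stree D), deg t = 1 \/ deg t = 3 &
        (rbar (cP c) < rbar (dP d))%R \/
        [/\ rbar (dP d) = rbar (cP c),
            @tree_subgraph (dP d) (@over_tree_vert _ _ _ d) (@over_tree_edge _ _ _ d) &
            excess (dP d) < excess (cP c)]].

Inductive operation := Replacement | AdmissibleDeformation.

Definition step (o : operation) (c c' : config) : Prop :=
  match o with
  | Replacement => c' = replacement c
  | AdmissibleDeformation => admissible_deformation c c'
  end.

Fixpoint run (tau : seq operation) (c c' : config) : Prop :=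
  if tau is o :: tau' then exists c1, step o c c1 /\ run tau' c1 c' else c' = c.

Fixpoint alternating (tau : seq operation) : Prop :=
  match tau with
  | o :: ((o' :: _) as tau') => o <> o' /\ alternating tau'
  | _ => True
  end.

(* Main.v *)
(* Replacing U and Z by P makes U = P, and the star of a vertex v of P is the union of
   the stars of its preimages q in X and Y. Preimages joined by a vertex of W(S1) share
   at least two edges, and all preimages of v are connected through W(S1). Hence a set
   of edges that contains the star of some q and every star of more than two edges at a
   preimage of v contains the whole star of v. Consequently a vertex of degree 3 has a
   preimage of degree 3; if deg v > 3, two distinct triples of edges lie in stars of
   preimages of v; and rbar(P) <= 3 (rbar(X) + rbar(Y)).

   If deg v > 3, take for T a caterpillar whose leaves are ordered so that the two
   triples have different middle elements. The preimage G of T in P_T is connected, and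
   outside G the graph P_T is P without v, so rbar(P_T) - rbar(P) = |EG| - |VG| + 1 >= 0,
   with equality only if G is a tree. In that case the sum of deg - 2 over the vertices
   of G is deg v - 2; the two triples give two vertices of G of degree at least 3, and so
   the excess decreases. As rbar(X), rbar(Y), rbar(W(S1)) do not change, rbar(P) stays
   bounded and the process terminates. *)
Require Import Defs.
From Stdlib Require List.
From mathcomp Require Import all_boot all_order all_algebra.
From mathcomp Require Import fingraph boolp zify.
(* Imported again so that [finv] is the edge inversion and not [fingraph.finv]. *)
Import Defs.

Set Implicit Arguments.
Unset Strict Implicit.
Unset Printing Implicit Defensive.

(** * Circuits and cores *)

(** The induction carries only the pushout square, local injectivity and degrees at least 2
    ([good]); subgroups and coverings enter once, to establish this for the initial graphs. A
    pushout is given by its universal property, but the argument needs to know what is identified in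
    it. Hence an explicit quotient is built and any pushout is shown to be a retract of it;
    equalities in $P$ then become chains through $W(S_1)$. In a caterpillar the hull of a set of
    leaves can be read off from their positions. It branches at the middle of each triple of its
    leaves, whatever other leaves it has, so a star larger than the triple does no harm. The map
    from $P_T$ to $U_T$ keeps the two branch points apart. Two of them are needed: when the preimage
    of $T$ is a tree, its sum of deg - 2 is deg v - 2, and replacing 2 by 3 lowers the sum by at
    least 1 at each branch point. So the new excess there is at most deg v - 4, against deg v - 3
    before; one branch point would not force a decrease. The factor 3 in the bound on rbar(P) is the
    least c with d <= c (d - 2) for all d >= 3. *)

Section Walks.
Variable G : graph.
Implicit Types (u v w : vert G) (e : edge G) (p q : seq (edge G)).

Lemma walk_cat u p q v :
  walk u (p ++ q) v <-> exists w, walk u p w /\ walk w q v.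
Proof.
elim: p u => [|e p IH] u /=.
  by split=> [h|[w [-> h]]] //; exists u.
split=> [[<- /IH[w [h1 h2]]]|[w [[<- h1] h2]]]; first by exists w.
by split=> //; apply/IH; exists w.
Qed.

Lemma src_einv e : src (einv e) = tgt e.
Proof. by []. Qed.

Lemma tgt_einv e : tgt (einv e) = src e.
Proof. by rewrite /tgt einvK. Qed.

Lemma rev_walk_cons e p : rev_walk (e :: p) = rcons (rev_walk p) (einv e).
Proof. by rewrite /rev_walk /= rev_cons. Qed.

Lemma walk_rev u p v : walk u p v -> walk v (rev_walk p) u.
Proof.
elim: p u => [|e p IH] u /=; first by move=> ->.
move=> [<- /IH h]; rewrite rev_walk_cons -cats1; apply/walk_cat.
by exists (tgt e); split=> //=; rewrite tgt_einv.
Qed.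

Lemma mem_rev_walk e p : List.In e (rev_walk p) <-> List.In (einv e) p.
Proof.
elim: p => [|e' p IH] //=; rewrite rev_walk_cons -cats1.
split=> [/List.in_app_iff[/IH ?|[<-|//]]|[->|/IH ?]].
- by right.
- by left; rewrite einvK.
- by apply/List.in_app_iff; right; left; rewrite einvK.
- by apply/List.in_app_iff; left.
Qed.

Lemma reduced_cat p e e' q :
  reduced (p ++ [:: e, e' & q]) <->
  [/\ reduced (rcons p e), e' <> einv e & reduced (e' :: q)].
Proof.
elim: p => [|a [|b p] IH] /=.
- by split=> [[]|[]].
- by split=> [[h []]|[[h _] ? ?]] //.
- split=> [[h /IH[h1 h2 h3]]|[[h h1] h2 h3]] //.
  by split=> //; apply/IH.
Qed.

Lemma reduced_rev p : reduced p -> reduced (rev_walk p).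
Proof.
elim: p => [|a [|b p] IH] // [ba h].
rewrite !rev_walk_cons -!cats1 -catA /=; apply/reduced_cat; split=> //.
  by move: (IH h); rewrite rev_walk_cons.
by rewrite einvK => E; apply: ba; rewrite E.
Qed.

Lemma circuit_rev p : circuit p -> circuit (rev_walk p).
Proof.
move=> [[v hv] [hr hl]]; split; first by exists v; apply: walk_rev.
split; first exact: reduced_rev.
case: p hl {hv hr} => [//|e p]; case/lastP: p => [|p e'] /=.
  by move=> h; rewrite /rev_walk /= => E; apply: h; rewrite -[LHS]einvK -E.
rewrite last_rcons rev_walk_cons /rev_walk map_rcons rev_rcons /= => h.
by rewrite last_rcons => E; apply: h; rewrite -[LHS]einvK -E.
Qed.

Lemma circuit_next p e : circuit p -> List.In e p ->
  exists2 e', List.In e' p & src e' = tgt e /\ e' <> einv e.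
Proof.
move=> [[v hv] [hr hl]] he; have [l1 [l2 E]] := List.in_split _ _ he.
case: l2 E => [|e' l2] E; rewrite {}E /= in hv hr hl *.
  (* Here [e] is the last edge: its successor is the first edge of [p], and backtracking is excluded
     by cyclic reducedness. *)
  case: l1 hv hl {hr he} => [|e0 l1] /= [<-].
    by move=> h h'; exists e; [left | split].
  move=> /walk_cat [w [_ [_ h]]]; rewrite last_cat /= => hl.
  by exists e0; [left | split].
exists e'; first by apply/List.in_app_iff; right; right; left.
split; last by case/reduced_cat: hr.
by case/walk_cat: hv => w [_ [_ []]].
Qed.

Lemma circuit_prev p e : circuit p -> List.In e p ->
  exists2 e', List.In e' p & tgt e' = src e /\ e <> einv e'.
Proof.
move=> hp he.
have [|e' he' [h1 h2]] := circuit_next (e := einv e) (circuit_rev hp).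
  by apply/mem_rev_walk; rewrite einvK.
exists (einv e'); first exact/mem_rev_walk.
split; first by rewrite tgt_einv h1 tgt_einv.
by rewrite einvK => E; apply: h2; rewrite einvK.
Qed.

Lemma core_edge_einv e : core_edge e -> core_edge (einv e).
Proof.
move=> [p [hp he]]; exists (rev_walk p); split; first exact: circuit_rev.
by apply/mem_rev_walk; rewrite einvK.
Qed.

(** The edge by which a circuit leaves [v] differs from the inverse of the edge by which it arrives.
    This is the origin of the lower bound 2 on the degrees in [X], [Y] and [W]. *)
Lemma core_vert_edges v : core_vert v ->
  exists e1 e2, [/\ core_edge e1, core_edge e2, src e1 = v, src e2 = v & e1 <> e2].
Proof.
move=> [e [he hv]].
wlog {hv} hv : e he / src e = v => [th|].
  by case: hv => [/th|hv]; [apply | apply: (th (einv e)) => //; apply: core_edge_einv].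
case: (he) => p [hp hep].
have [e' he' [h1 h2]] := circuit_prev hp hep.
exists e, (einv e'); split=> //; last by rewrite src_einv h1.
by apply: core_edge_einv; exists p.
Qed.

(* An edge [e] of a circuit with [tgt e] of maximal depth is followed by [up (tgt e)]; *)
(* since its predecessor is not deeper, [e] is the inverse of that edge. *)
Lemma no_circuit (B : edge G -> Prop) (depth : vert G -> nat) (up : vert G -> edge G) :
    (forall e, B e -> e = up (src e) /\ depth (tgt e) < depth (src e) \/
                      einv e = up (tgt e) /\ depth (src e) < depth (tgt e)) ->
  ~ exists p, circuit p /\ forall e, List.In e p -> B e.
Proof.
move=> hB [p [hp pB]].
have [e0 he0] : exists e, List.In e p.
  by case: p hp {pB} => [[_ []]//|e p] _; exists e; left.
have [e he hmax] : exists2 e, List.In e p &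
    forall e', List.In e' p -> depth (tgt e') <= depth (tgt e).
  elim: p e0 he0 {hp pB} => // a p IH e0 _.
  case: p IH => [|b p] IH; first by exists a; [left | move=> e' [<-|]].
  have [e he hm] := IH b (or_introl erefl).
  case: (leqP (depth (tgt a)) (depth (tgt e))) => h.
    by exists e; [right | move=> e' [<-|/hm]].
  exists a; [by left | move=> e' [<-//|/hm h']].
  exact: leq_trans h' (ltnW h).
have [e1 he1 [s1 n1]] := circuit_next hp he.
have [e2 he2 [s2 n2]] := circuit_prev hp he.
have u1 : e1 = up (tgt e).
  case: (hB _ (pB _ he1)) => [[-> _]|[_]]; rewrite s1 // => h.
  by have := hmax _ he1; rewrite leqNgt h.
case: (hB _ (pB _ he)) => [[_ h]|[h _]].
  by have := hmax _ he2; rewrite s2 leqNgt h.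
by apply: n1; rewrite h.
Qed.

End Walks.

(** * Counting in finite graphs *)

Section FinGraph.
Variable G : finGraph.
Implicit Types (v : fvert G) (e : fedge G).

Definition star v : {set fedge G} := [set e | fsrc e == v].

Lemma deg_star v : deg v = #|star v|.
Proof. by []. Qed.

Lemma finv_inj : injective (@finv G).
Proof. exact: inv_inj (@finvK G). Qed.

Lemma card_fedge : #|fedge G| = (#|fedge G|./2).*2.
Proof.
(* One orientation of each nonoriented edge; there are no ties, as no edge is its own inverse. *)
pose A := [set e : fedge G | enum_rank e < enum_rank (finv e)].
have E : ~: A = [set finv e | e in A].
  apply/setP=> e; rewrite !inE -leqNgt -[e in RHS]finvK mem_imset; last exact: finv_inj.
  rewrite inE finvK leq_eqVlt; case: eqP => // /val_inj/enum_rank_inj/finv_neq [].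
have := cardsC A; rewrite E card_imset; last exact: finv_inj.
by rewrite -cardsT cardsT addnn => <-; rewrite doubleK.
Qed.

Lemma sum_deg_in (A : pred (fvert G)) :
  \sum_(v | A v) deg v = #|[set e : fedge G | A (fsrc e)]|.
Proof.
rewrite -sum1_card (partition_big (@fsrc G) A) /=; last by move=> e; rewrite inE.
apply: eq_bigr => v Av; rewrite /deg -sum1_card; apply: eq_bigl => e.
by rewrite !inE; case: eqP => [->|]; rewrite ?Av ?andbF.
Qed.

Lemma sum_deg : \sum_(v : fvert G) deg v = #|fedge G|.
Proof. by rewrite (sum_deg_in predT) -cardsT; apply: eq_card => e; rewrite !inE. Qed.

(** Doubling removes the halved edge count, so that later comparisons are linear in the numbers of
    vertices and oriented edges. *)
Lemma rbarE : (rbar G *+ 2 = #|fedge G|%:Z - (2 * #|fvert G|)%:Z)%R.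
Proof. rewrite /rbar {2}card_fedge; lia. Qed.

End FinGraph.

(** * Spanning trees and the Euler characteristic of connected subgraphs *)

Section ConnectedSubgraph.
Variables (G : finGraph) (A : {set fvert G}) (B : {set fedge G}) (r : fvert G).
Hypotheses (rA : r \in A).
Hypothesis AB : @connected_subgraph G (fun v => v \in A) (fun e => e \in B).

Let root_walk v n := exists p : seq (fedge G),
  [/\ size p = n, @walk G v p r & forall e, List.In e p -> e \in B].

(** The implication makes the distance to [r] inside the subgraph a total function, with value 0 off
    [A]. *)
Let depth_ex v : exists n, `[< v \in A -> root_walk v n >].
Proof.
case: (boolP (v \in A)) => vA; last by exists 0; apply/asboolP.
have [p [h1 h2]] := AB.2 _ _ vA rA.
by exists (size p); apply/asboolP => _; exists p.
Qed.

Let depth v := ex_minn (depth_ex v).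

Let is_up v e := [&& e \in B, fsrc e == v & depth (fsrc (finv e)) < depth v].

Let up_ex v : v \in A -> v != r -> exists e, is_up v e.
Proof.
move=> vA vr; rewrite /is_up {2}/depth.
case: ex_minnP => n /asboolP /(_ vA) [[|e p] [<- /= h1 h2] _].
  by rewrite h1 eqxx in vr.
case: h1 => <- h; exists e; rewrite h2 /=; last by left.
rewrite eqxx /= /depth; case: ex_minnP => m _ /(_ (size p)); apply.
by apply/asboolP => _; exists p; split=> // e' he'; apply: h2; right.
Qed.

Let up v := [pick e | is_up v e].

Let upP v : v \in A -> v != r -> exists2 e, up v = Some e & is_up v e.
Proof.
move=> vA vr; rewrite /up; case: pickP => [e he|h]; first by exists e.
by have [e] := up_ex vA vr; rewrite h.
Qed.

(** A spanning tree of the subgraph, each edge oriented towards [r]. *)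
Let ups := [set e | [exists (v | (v \in A) && (v != r)), up v == Some e]].

Let ups_is_up e : e \in ups -> [/\ fsrc e \in A, up (fsrc e) = Some e & is_up (fsrc e) e].
Proof.
rewrite inE => /existsP[v /andP[/andP[vA vr] /eqP E]].
have [e' E'] := upP vA vr; rewrite E' in E; case: E => <- h.
by have /and3P[_ /eqP -> _] := h.
Qed.

Let card_ups : #|ups| = #|A|.-1.
Proof.
rewrite (cardsD1 r A) rA /=.
apply/esym; rewrite -(card_in_imset (f := up)); last first.
  move=> v w; rewrite !inE => /andP[vr vA] /andP[wr wA].
  have [e -> /and3P[_ /eqP <- _]] := upP vA vr.
  by have [e' -> /and3P[_ /eqP <- _]] := upP wA wr => -[->].
rewrite -(card_imset ups (@Some_inj _)); apply: eq_card => o.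
apply/imsetP/imsetP => [[v]|[e he ->]].
  rewrite !inE => /andP[vr vA] ->; have [e E h] := upP vA vr.
  by exists e => //; rewrite inE; apply/existsP; exists v; rewrite vA vr E eqxx.
move: he; rewrite inE => /existsP[v /andP[/andP[vA vr] /eqP E]].
by exists v; rewrite ?inE ?vA ?vr.
Qed.

(** The depth drops along every edge of [ups], so none occurs in both orientations. *)
Let ups_disj : [disjoint ups & [set finv e | e in ups]].
Proof.
apply/pred0P => e /=; apply/negP => /andP[h1 /imsetP[e' h2 E]].
have [_ _ /and3P[_ _ l1]] := ups_is_up h1; have [_ _ /and3P[_ _ l2]] := ups_is_up h2.
rewrite E finvK in l1; have := ltn_trans l1 l2; by rewrite ltnn.
Qed.

Let ups_sub : ups :|: [set finv e | e in ups] \subset B.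
Proof.
apply/subsetP=> e /setUP[/ups_is_up[_ _ /and3P[]]//|/imsetP[e' /ups_is_up[_ _ /and3P[h _ _]] ->]].
by have [] := AB.1 _ h.
Qed.

Let card_upsU : #|ups :|: [set finv e | e in ups]| = 2 * #|A|.-1.
Proof.
rewrite cardsU disjoint_setI0 // cards0 subn0 card_imset; last exact: finv_inj.
by rewrite card_ups mul2n addnn.
Qed.

Lemma connected_card : 2 * #|A| <= #|B| + 2.
Proof.
have := subset_leq_card ups_sub; rewrite card_upsU.
by have : 0 < #|A| by [apply/card_gt0P; exists r]; lia.
Qed.

(** Equality leaves no edge of [B] outside the spanning tree, where every edge goes to a parent or
    comes from one, as [no_circuit] requires. *)
Lemma connected_card_tree : 2 * #|A| = #|B| + 2 ->
  @tree_subgraph G (fun v => v \in A) (fun e => e \in B).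
Proof.
move=> E; split; [by exists r | split=> //].
have EB : ups :|: [set finv e | e in ups] = B.
  by apply/eqP; rewrite eqEcard ups_sub card_upsU; lia.
move=> [[|e0 p] hp]; first by case: hp => -[_ []].
apply: (@no_circuit G (fun e => e \in B) depth (fun v => odflt e0 (up v))); last by exists (e0 :: p).
move=> e; rewrite -EB => /setUP[h|/imsetP[e' h ->]].
  by have [_ /= -> /and3P[_ _ ?]] := ups_is_up h; left.
by have [_ E' /and3P[_ _ ?]] := ups_is_up h; right; rewrite /tgt /= finvK E'.
Qed.

End ConnectedSubgraph.

(** * Caterpillars and their hulls *)

Section Caterpillar.
Variable n : nat.

(* The spine vertex s_i is [(i, false)] and the pendant vertex l_i, for        *)
(* [0 < i < n], is [(i, true)]; the ends s_0 and s_n of the spine are leaves.  *)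
Definition cat_vert : finType := {z : 'I_n.+1 * bool | z.2 ==> (0 < z.1 < n)}.

Definition spine (i : 'I_n.+1) : cat_vert := Sub (i, false) isT.

(** The tree is rooted at the end s_0 of the spine. The root is its own parent, but [cat_edge]
    admits only positive indices. *)
Definition cat_parent (v : cat_vert) : cat_vert :=
  spine (if (val v).2 then (val v).1 else inord (val v).1.-1).

(* [(v, true)] goes from [v] to its parent, and [(v, false)] is its inverse. *)
Definition cat_edge : finType := {z : cat_vert * bool | 0 < (val z.1).1}.

Definition cat_src (e : cat_edge) : cat_vert :=
  if (val e).2 then (val e).1 else cat_parent (val e).1.

Definition cat_inv (e : cat_edge) : cat_edge :=
  Sub ((val e).1, ~~ (val e).2) (valP e).

Lemma cat_invK : involutive cat_inv.
Proof. by case=> -[v o] h; apply: val_inj; rewrite /= negbK. Qed.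

Lemma cat_inv_neq e : cat_inv e <> e.
Proof. by case: e => -[v []] h /(congr1 val). Qed.

Definition caterpillar : finGraph := FinGraph cat_src cat_invK cat_inv_neq.

Lemma cat_leaf_subproof (i : 'I_n.+1) : (i, 0 < i < n).2 ==> (0 < (i, 0 < i < n).1 < n).
Proof. exact: implybb. Qed.

(** The boolean selects the pendant vertex for inner indices and the spine itself at both ends,
    which gives n + 1 leaves in a linear order. *)
Definition cat_leaf (i : 'I_n.+1) : cat_vert := Sub (i, 0 < i < n) (cat_leaf_subproof i).

Lemma cat_leaf_inj : injective cat_leaf.
Proof. by move=> i j /(congr1 val) []. Qed.

Definition cat_depth (v : cat_vert) : nat := (val v).1 * 2 + (val v).2.

Lemma cat_parent_depth (v : cat_vert) : 0 < (val v).1 -> cat_depth (cat_parent v) < cat_depth v.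
Proof.
case: v => -[i []] h /= i0; rewrite /cat_depth /=; first lia.
rewrite inordK; last by apply: leq_ltn_trans (leq_pred _) (ltn_ord i).
lia.
Qed.

Definition up_edge (v : cat_vert) (h : 0 < (val v).1) : cat_edge := Sub (v, true) h.
Definition down_edge (v : cat_vert) (h : 0 < (val v).1) : cat_edge := Sub (v, false) h.

Lemma cat_edge_eq (e e' : cat_edge) : (val e').1 = (val e).1 -> e = e' \/ e = cat_inv e'.
Proof.
case: e e' => -[v o] h [[v' o'] h'] /= E; case: (eqVneq o o') => [oo|no].
  by left; apply: val_inj; rewrite /= E oo.
by right; apply: val_inj; rewrite /= E; case: o o' no {h h'} => [] [].
Qed.

Section Hull.
Variable I : {set 'I_n.+1}.

(** The minimal subtree spanned by the leaves with index in [I], once [I] has two elements; for a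
    single inner index this description has a whole pendant edge instead of one vertex. *)
Definition cat_hullv (v : cat_vert) : bool :=
  if (val v).2 then (val v).1 \in I
  else [exists j in I, j <= (val v).1] && [exists j in I, (val v).1 <= j].

(** Tells whether the edge from [v] to its parent is in the hull. The edge from s_i to s_(i-1)
    separates the leaves of index at least i from those of smaller index, whence the strict
    inequality on one side only. *)
Definition cat_hullb (v : cat_vert) : bool :=
  if (val v).2 then (val v).1 \in I
  else [exists j in I, j < (val v).1] && [exists j in I, (val v).1 <= j].

Definition cat_hulle (e : cat_edge) : bool := cat_hullb (val e).1.

Lemma cat_hullbv v : cat_hullb v -> cat_hullv v.
Proof.
rewrite /cat_hullb /cat_hullv; case: ifP => // _ /andP[/existsP[j /andP[h1 h2]] ->].
by rewrite andbT; apply/existsP; exists j; rewrite h1 ltnW.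
Qed.

Lemma cat_hullb_parent (v : cat_vert) : 0 < (val v).1 -> cat_hullb v -> cat_hullv (cat_parent v).
Proof.
case: v => -[i b] /= h i0; rewrite /cat_hullb /cat_hullv /=; case: b {h} => [iI|].
  by apply/andP; split; apply/existsP; exists i; rewrite iI /=.
have i1 : i.-1 < n.+1 by apply: leq_ltn_trans (leq_pred _) (ltn_ord i).
move=> /andP[/existsP[j /andP[h1 h2]] /existsP[k /andP[h3 h4]]].
apply/andP; split; apply/existsP; [exists j | exists k]; rewrite ?h1 ?h3 inordK //=; lia.
Qed.

Lemma cat_hull_sub :
  @is_subgraph caterpillar (fun v => cat_hullv v) (fun e => cat_hulle e).
Proof.
case=> -[v o] h /= he; split=> //; rewrite /cat_src /=.
by case: o h he => h he; [exact: cat_hullbv | exact: cat_hullb_parent].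
Qed.

Lemma cat_hull_leaf i : i \in I -> cat_hullv (cat_leaf i).
Proof.
move=> iI; rewrite /cat_hullv /=; case: ifP => // _.
by apply/andP; split; apply/existsP; exists i; rewrite iI /=.
Qed.

(** The hull is itself a rooted tree with root [spine m]: exactly its other vertices have their
    parent edge in it. Connectedness and the count of vertices against edges both rest on this. *)
Lemma cat_hullv_min m v : m \in I -> (forall i, i \in I -> m <= i) ->
  cat_hullv v = cat_hullb v || (v == spine m).
Proof.
move=> mI hm; case: v => -[i b] h; rewrite /cat_hullb /cat_hullv -val_eqE /= xpair_eqE.
case: b {h}; rewrite ?andbF ?orbF // ?andbT.
case: (boolP [exists j in I, i <= j]) => [|hn]; rewrite ?andbT ?andbF /=; last first.
  by case: eqP => // E; rewrite E in hn; case/existsP: hn; exists m; rewrite mI /=.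
move=> _; case: (ltngtP m i) => him.
- by apply/idP/orP => _; [left|]; apply/existsP; exists m; rewrite mI //= ltnW.
- apply/idP/orP => [/existsP[j /andP[/hm h1 h2]]|[/existsP[j /andP[/hm h1 h2]]|/eqP E]].
  + lia.
  + lia.
  + by rewrite E ltnn in him.
apply/idP/orP => _; first by right; apply/eqP/val_inj.
by apply/existsP; exists m; rewrite mI him /=.
Qed.

Lemma cat_hullb_gt0 (v : cat_vert) : cat_hullb v -> 0 < (val v).1.
Proof.
case: v => -[i b] h; rewrite /cat_hullb /=; case: b h => [/andP[]//|_].
by case/andP=> /existsP[j /andP[_ h]] _; exact: leq_ltn_trans h.
Qed.

Lemma cat_hull_min_walk m v : m \in I -> (forall i, i \in I -> m <= i) -> cat_hullv v ->
  exists p, @walk caterpillar v p (spine m) /\ forall e, List.In e p -> cat_hulle e.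
Proof.
move=> mI hm; have [k] := ubnP (cat_depth v); elim: k v => // k IH v hk hv.
have := hv; rewrite (cat_hullv_min _ mI hm) => /orP[hb|/eqP ->]; last by exists [::].
have v0 := cat_hullb_gt0 hb.
have [|p [h1 h2]] := IH (cat_parent v) _ (cat_hullb_parent v0 hb).
  by have := cat_parent_depth v0; lia.
by exists (up_edge v0 :: p); split=> [|e [<-|/h2]].
Qed.

Lemma cat_hull_connected :
  @connected_subgraph caterpillar (fun v => cat_hullv v) (fun e => cat_hulle e).
Proof.
split=> [|u v hu hv]; first exact: cat_hull_sub.
have [i0 i0I] : exists i, i \in I.
  move: hu; rewrite /cat_hullv; case: ifP => _ h; first by exists (val u).1.
  by case/andP: h => /existsP[j /andP[]]; exists j.
case: (@arg_minnP _ i0 (mem I) (@nat_of_ord n.+1) i0I) => m mI hm.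
have [p [p1 p2]] := cat_hull_min_walk mI hm hu.
have [q [q1 q2]] := cat_hull_min_walk mI hm hv.
exists (p ++ @rev_walk caterpillar q); split.
  by apply/walk_cat; exists (spine m); split=> //; apply: walk_rev.
move=> e /List.in_app_iff[/p2//|/(mem_rev_walk e) /q2].
by case: e => -[].
Qed.

Lemma cat_hull_card : I != set0 -> 2 * #|cat_hullv| = #|cat_hulle| + 2.
Proof.
case/set0Pn=> i0 i0I.
case: (@arg_minnP _ i0 (mem I) (@nat_of_ord n.+1) i0I) => m mI hm.
have -> : #|cat_hullv| = #|cat_hullb|.+1.
  rewrite (cardD1 (spine m)) [_ \in _](cat_hullv_min _ mI hm) eqxx orbT add1n; congr S.
  apply: eq_card => v; rewrite inE /= [X in _ && X](cat_hullv_min _ mI hm) andbC.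
  case: eqP => [->|_]; rewrite ?orbF ?andbT // ?andbF; apply/esym/negbTE.
  by apply/negP=> /andP[/existsP[j /andP[/hm /= h1 h2]] _]; lia.
suff -> : #|cat_hulle| = #|cat_hullb| * 2 by lia.
rewrite -card_bool -cardX -(card_image (f := val : cat_edge -> _) val_inj cat_hulle).
apply: eq_card => x; case: x => v o; rewrite !inE /= andbT.
apply/imageP/idP => [[[[v' o'] h] he /= [-> _]] //|hb].
by exists (Sub (v, o) (cat_hullb_gt0 hb)).
Qed.

(** The descendants [w] of [v], that is, the side of [v] after removal of the edge from [v] to its
    parent. *)
Definition cat_below (v w : cat_vert) : bool :=
  if (val v).2 then w == v else (val v).1 <= (val w).1.

Lemma cat_below_parent (v w : cat_vert) : 0 < (val w).1 ->
  cat_below v w != cat_below v (cat_parent w) -> w = v.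
Proof.
case: v w => -[i b] hi [[j c] hj] /= j0; rewrite /cat_below /=.
case: b hi => hi.
  rewrite -![_ == Sub _ _]val_eqE /= [in X in _ != X]xpair_eqE andbF eqbF_neg negbK.
  by move/eqP=> E; apply: val_inj.
case: c hj => hj /=; first by rewrite eqxx.
rewrite inordK; last by apply: leq_ltn_trans (leq_pred _) (ltn_ord j).
by move=> h; apply: val_inj; congr (_, _); apply: val_inj => /=; lia.
Qed.

(** Every edge of a tree is a bridge: a walk that changes sides contains it in one of the two
    orientations. *)
Lemma cat_walk_cross v u p w : @walk caterpillar u p w ->
  cat_below v u != cat_below v w -> exists2 e, List.In e p & (val e).1 = v.
Proof.
elim: p u => [|e p IH] u /=; first by move=> ->; rewrite eqxx.
move=> [<- hp] h.
case: (eqVneq (cat_below v (@tgt caterpillar e)) (cat_below v w)) => [E|N].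
  exists e; first by left.
  case: e h E {hp} => -[x []] hx; rewrite /tgt /cat_src /= /cat_src /= => h E.
    by apply: cat_below_parent hx _; rewrite E.
  by apply: cat_below_parent hx _; rewrite E eq_sym.
by have [e' h1 h2] := IH _ hp N; exists e' => //; right.
Qed.

(** Each edge of the described hull separates two leaves of [I], so a connected subgraph containing
    both must cross it. *)
Lemma cat_hulle_min (A : cat_vert -> Prop) (B : cat_edge -> Prop) e : 1 < #|I| ->
  @connected_subgraph caterpillar A B -> (forall i, i \in I -> A (cat_leaf i)) ->
  cat_hulle e -> B e.
Proof.
move=> /card_gt1P[x [y [xI yI xy]]] [AB1 AB2] LA he.
have [i [j [iI jI hij]]] : exists i j, [/\ i \in I, j \in I &
    cat_below (val e).1 (cat_leaf i) != cat_below (val e).1 (cat_leaf j)].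
  case: e he => -[[[k b] hk] o] h; rewrite /cat_hulle /cat_hullb /cat_below /=.
  case: b hk h => hk h; last first.
    move=> /andP[/existsP[i /andP[h1 h2]] /existsP[j /andP[h3 h4]]].
    by exists i, j; split=> //; lia.
  move=> kI; have hk' : 0 < k < n := hk.
  have hl z : cat_leaf z == Sub (k, true) hk = (z == k).
    by rewrite -val_eqE /= xpair_eqE; case: eqP => // ->; rewrite hk'.
  (* On one side of a pendant edge there is only its own leaf [k]; any other element of [I] is on
     the other side. *)
  exists k; case: (eqVneq x k) => [xk|nxk]; [exists y | exists x]; split=> //; rewrite !hl eqxx.
    by move: xy; rewrite xk eq_sym => /negbTE ->.
  by rewrite (negbTE nxk).
have [p [p1 p2]] := AB2 _ _ (LA _ iI) (LA _ jI).
have [e' /p2 h1 h2] := cat_walk_cross p1 hij.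
have [_ h3] := AB1 _ h1.
by case: (cat_edge_eq h2) => ->.
Qed.

End Hull.
End Caterpillar.

Section CaterpillarTree.
Variable n : nat.
Notation cat := (caterpillar n).
Implicit Types (v : cat_vert n) (e : cat_edge n) (i : 'I_n.+1).

Section HullE.
Variables (I : {set 'I_n.+1}) (L : cat_vert n -> Prop).
Hypotheses (cardI : 1 < #|I|) (LE : forall v, L v <-> exists2 i, i \in I & cat_leaf i = v).

Lemma cat_hull_edgeE e : @hull_edge cat L e <-> cat_hulle I e.
Proof.
split=> [h|he A B AB LA].
  apply: (h _ _ (cat_hull_connected I)).
  by move=> v /LE[i iI <-]; apply: cat_hull_leaf.
by apply: (cat_hulle_min cardI AB _ he) => i iI; apply/LA/LE; exists i.
Qed.

(** Prepares the degree bound for lifted graphs: at a leaf in [L] the missing second edge will be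
    the remaining part of the edge whose ray ends there. *)
Lemma cat_hull_star v : cat_hullv I v ->
  exists e, [/\ cat_hulle I e, @fsrc cat e = v &
    L v \/ exists e', [/\ e' <> e, cat_hulle I e' & @fsrc cat e' = v]].
Proof.
case: v => -[i b] h.
case: b h => h.
  move=> iI; have hi : 0 < i < n := h.
  have i0 : 0 < i by case/andP: hi.
  exists (up_edge (v := Sub (i, true) h) i0); split=> //; left.
  by apply/LE; exists i => //; apply: val_inj; rewrite /= hi.
move=> hv; have {hv} [hL hR] : [exists j in I, j <= i] /\ [exists j in I, i <= j] by apply/andP.
have Lf : i \in I -> ~~ (0 < i < n) -> L (Sub (i, false) h).
  move=> iI /negbTE E; apply/LE; exists i => //; apply: val_inj => /=; by rewrite E.
have pend : i \in I -> 0 < i < n -> exists e',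
    [/\ ~~ (val e').2, (val (val e').1).2 , cat_hulle I e' & @fsrc cat e' = Sub (i, false) h].
  move=> iI hi; have i0 : 0 < (val (cat_leaf i)).1 by case/andP: hi.
  exists (down_edge i0); rewrite /= hi; split=> //; first by rewrite /cat_hulle /cat_hullb /= hi.
  by apply: val_inj; rewrite /= /cat_src /= /cat_parent /= hi.
have up : [exists j in I, j < i] -> exists e',
    [/\ (val e').2, cat_hulle I e' & @fsrc cat e' = Sub (i, false) h].
  move=> hj; have i0 : 0 < (val (Sub (i, false) h : cat_vert n)).1.
    by case/existsP: hj => j /andP[_ hj]; apply: leq_ltn_trans hj.
  exists (up_edge i0); split=> //; by rewrite /cat_hulle /cat_hullb /= hj hR.
have down : [exists j in I, i < j] -> exists e',
    [/\ ~~ (val e').2, ~~ (val (val e').1).2, cat_hulle I e' & @fsrc cat e' = Sub (i, false) h].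
  move=> /existsP[j /andP[jI ij]].
  have i1 : i.+1 < n.+1 by apply: leq_ltn_trans ij (ltn_ord j).
  have i0 : 0 < (val (spine (Ordinal i1))).1 by [].
  exists (down_edge i0); split=> //.
    rewrite /cat_hulle /cat_hullb /=; apply/andP; split.
      by case/existsP: hL => k /andP[h1 h2]; apply/existsP; exists k; rewrite h1 ltnS.
    by apply/existsP; exists j; rewrite jI.
  by apply: val_inj; rewrite /= /cat_src /= /cat_parent /= inord_val.
(* If [I] does not continue on both sides, then [i] is its minimum or maximum, and the pendant edge
   or membership in [L] replaces the missing direction. *)
have iI : ~~ ([exists j in I, j < i] && [exists j in I, i < j]) -> i \in I.
  case/existsP: hL => j /andP[jI]; rewrite leq_eqVlt => /orP[/eqP/val_inj <- //|ji].
  case/existsP: hR => k /andP[kI]; rewrite leq_eqVlt => /orP[/eqP/val_inj -> //|ki].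
  move=> /negP[]; apply/andP; split; apply/existsP; [exists j | exists k]; exact/andP.
have any : [exists j in I, j < i] || [exists j in I, i < j].
  case/card_gt1P: cardI => x [y [xI yI xy]].
  have [ix|] := eqVneq x i.
    have : y != i by rewrite -ix eq_sym.
    rewrite -val_eqE neq_ltn => /orP[?|?]; apply/orP; [left|right];
      by apply/existsP; exists y; apply/andP.
  rewrite -val_eqE neq_ltn => /orP[?|?]; apply/orP; [left|right];
      by apply/existsP; exists x; apply/andP.
case: (boolP [exists j in I, j < i]) any iI up => hl /=.
  case: (boolP [exists j in I, i < j]) down => hr down _ /= iI /(_ isT) [e [e1 e2 e3]].
    have [e' [f1 f2 f3 f4]] := down isT; exists e; split=> //; right; exists e'; split=> //.
    by move=> E; rewrite E e1 in f1.
  have {}iI := iI isT; exists e; split=> //.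
  case: (boolP (0 < i < n)) => hi; last by left; apply: Lf.
  have [e' [f1 f2 f3 f4]] := pend iI hi; right; exists e'; split=> //.
  by move=> E; rewrite E e1 in f1.
move=> hr /(_ isT) iI _; have [e [e1 e2 e3 e4]] := down hr; exists e; split=> //.
case: (boolP (0 < i < n)) => hi; last by left; apply: Lf.
have [e' [f1 f2 f3 f4]] := pend iI hi; right; exists e'; split=> //.
by move=> E; rewrite E (negbTE e2) in f2.
Qed.

Lemma cat_hull_vertE v : @hull_vert cat L v <-> cat_hullv I v.
Proof.
split=> [h|hv A B AB LA].
  apply: (h _ _ (cat_hull_connected I)).
  by move=> w /LE[i iI <-]; apply: cat_hull_leaf.
have [e [/cat_hull_edgeE he <- _]] := cat_hull_star hv.
by case: (AB) => [/(_ _ (he _ _ AB LA)) []].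
Qed.

End HullE.

(** The three edges at s_j lead to s_(j-1), to the leaf l_j and to s_(j+1); they separate [i], [j]
    and [k] from each other. *)
Lemma cat_hull_branch (I : {set 'I_n.+1}) i j k :
    i \in I -> j \in I -> k \in I -> i < j < k ->
  exists e1 e2 e3, [/\ [/\ e1 <> e2, e1 <> e3 & e2 <> e3],
    [/\ cat_hulle I e1, cat_hulle I e2 & cat_hulle I e3] &
    [/\ @fsrc cat e1 = spine j, @fsrc cat e2 = spine j & @fsrc cat e3 = spine j]].
Proof.
move=> iI jI kI /andP[ij jk].
have hj : 0 < j < n by rewrite (leq_ltn_trans _ ij) //= -ltnS (leq_ltn_trans jk).
have j0 : 0 < (val (spine j)).1 by case/andP: hj.
have j0' : 0 < (val (cat_leaf j)).1 by case/andP: hj.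
have j1 : j.+1 < n.+1 by case/andP: hj.
have j10 : 0 < (val (spine (Ordinal j1))).1 by [].
exists (up_edge j0), (down_edge j0'), (down_edge j10); split.
- split=> /(congr1 val) [] //; by rewrite hj.
- rewrite /cat_hulle /cat_hullb /= hj; split=> //; apply/andP; split; apply/existsP.
  + by exists i; rewrite iI.
  + by exists j; rewrite jI /=.
  + by exists j; rewrite jI /=.
  + by exists k; rewrite kI.
by split; apply: val_inj; rewrite /= /cat_src /cat_parent /= ?hj // inord_val.
Qed.

Lemma cat_hullb_setT v : 0 < (val v).1 -> cat_hullb setT v.
Proof.
move=> v0; rewrite /cat_hullb; case: ifP => _; first by rewrite inE.
apply/andP; split; apply/existsP; first by exists ord0; rewrite inE.
by exists (val v).1; rewrite inE /=.
Qed.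

(** The caterpillar is the hull of all its leaves, so the count for hulls gives the equality case of
    [connected_card]. *)
Lemma cat_tree : is_tree cat.
Proof.
have hE : cat_hulle (n := n) setT =1 xpredT by case=> -[v o] h; apply: cat_hullb_setT.
have hV : cat_hullv (n := n) setT =1 xpredT.
  move=> v; rewrite /cat_hullv; case: ifP => _; first by rewrite inE.
  by apply/andP; split; apply/existsP; exists (val v).1; rewrite inE /=.
have conn := cat_hull_connected (n := n) setT.
have cc : @connected_subgraph cat (fun v => v \in [set: fvert cat]) (fun e => e \in [set: fedge cat]).
  split=> [e|u v _ _]; rewrite ?inE //.
  have [p [p1 _]] := conn.2 u v (hV u) (hV v).
  by exists p; split=> // e _; rewrite inE.
have := connected_card_tree (G := cat) (r := spine ord0) (in_setT _) cc.
rewrite /is_tree.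
have -> : (fun=> True) = (fun v => v \in [set: fvert cat]) by apply: funext => v; rewrite inE propeqE.
have -> : (fun=> True) = (fun e => e \in [set: fedge cat]) by apply: funext => v; rewrite inE propeqE.
apply; have := @cat_hull_card n setT; rewrite (eq_card hV) (eq_card hE) !cardsT; apply.
by apply/set0Pn; exists ord0; rewrite inE.
Qed.

Lemma cat_deg v : 0 < n -> @deg cat v = if v == cat_leaf (val v).1 then 1 else 3.
Proof.
move=> n0; rewrite /deg; case: v => -[i b]; case: b => h.
  have hi : 0 < i < n := h.
  have i0 : 0 < (val (Sub (i, true) h : cat_vert n)).1 by case/andP: hi.
  rewrite -val_eqE /= hi eqxx; transitivity #|[set up_edge i0]|; last by rewrite cards1.
  apply: eq_card => -[[w o] hw].
  rewrite !inE -!val_eqE /= !xpair_eqE /cat_src /=; case: o hw => /= hw; rewrite ?andbF ?andbT //.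
  by rewrite !xpair_eqE andbF.
(* The candidates at s_i are its own upward edge and the reversed edges of its children l_i and
   s_(i+1); the guard [i < n] discards the default value of [inord]. *)
have starE e : (@fsrc cat e == Sub (i, false) h) =
   if (val e).2 then (val e).1 == Sub (i, false) h
   else (val (val e).1 == (i, true)) || (val (val e).1 == (inord i.+1, false)) && (i < n).
  case: e => -[[[j c] hj] o] j0; rewrite -!val_eqE /= /cat_src /=; case: o j0 => //= j0.
  rewrite !xpair_eqE andbT; case: c hj j0 => hj j0 /=; first by rewrite andbF orbF andbT.
  rewrite andbF /= andbT -!val_eqE /= inordK; last by apply: leq_ltn_trans (leq_pred _) (ltn_ord j).
  have := ltn_ord j; have /= := j0.
  case: (ltnP i n) => hi; first by rewrite inordK //; lia.
  by rewrite andbF; lia.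
have hv : (Sub (i, false) h == cat_leaf i :> cat_vert n) = ~~ (0 < i < n).
  by rewrite -val_eqE /= xpair_eqE eqxx; case: (0 < i < n).
rewrite /= hv.
pose v : cat_vert n := Sub (i, false) h.
case: (posnP i) => i0.
  have i1 : i.+1 < n.+1 by rewrite i0.
  have i10 : 0 < (val (spine (Ordinal i1))).1 by [].
  rewrite /=; transitivity #|[set down_edge i10]|; last by rewrite cards1.
  apply: eq_card => e; rewrite !inE starE -val_eqE /=.
  case: e => -[[[j c] hj] o] j0; rewrite /= !xpair_eqE -!val_eqE /= xpair_eqE -!val_eqE /=.
  rewrite xpair_eqE -!val_eqE /= inordK //.
  by have /= := j0; case: c hj j0 => /=; case: o => //= hj j0; rewrite ?andbF ?andbT //; lia.
have i0v : 0 < (val v).1 by [].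
case: (ltnP i n) => hi /=; last first.
  transitivity #|[set up_edge i0v]|; last by rewrite cards1.
  apply: eq_card => e; rewrite !inE starE -val_eqE /=.
  case: e => -[[[j c] hj] o] j0; rewrite /= !xpair_eqE -!val_eqE /= xpair_eqE -!val_eqE /=.
  rewrite xpair_eqE -!val_eqE /= [i < n]ltnNge hi andbF orbF.
  have hj' : c ==> (0 < j < n) := hj.
  move: hj' {hj j0}; case: c; case: o => /=; rewrite ?andbF ?andbT //; lia.
have i1 : i.+1 < n.+1 by [].
have i10 : 0 < (val (spine (Ordinal i1))).1 by [].
have il0 : 0 < (val (cat_leaf i)).1 by [].
transitivity #|up_edge i0v |: (down_edge il0 |: [set down_edge i10])|; last first.
  have H1 : up_edge i0v != down_edge il0 by rewrite -val_eqE /= xpair_eqE andbF.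
  have H2 : up_edge i0v != down_edge i10 by rewrite -val_eqE /= xpair_eqE andbF.
  have H3 : down_edge il0 != down_edge i10.
    by rewrite -val_eqE /= xpair_eqE -val_eqE /= xpair_eqE -val_eqE /= hi i0 andbF.
  by rewrite !cardsU1 cards1 !inE (negbTE H1) (negbTE H2) (negbTE H3).
apply: eq_card => e; rewrite !inE starE -!val_eqE /=.
case: e => -[[[j c] hj] o] j0; rewrite /= !xpair_eqE -!val_eqE /= !xpair_eqE -!val_eqE /=.
rewrite inordK // hi i0 /=; case: c hj j0 => /=; case: o => //= hj j0; rewrite ?andbF ?andbT ?orbF //.
Qed.

End CaterpillarTree.

(** * Pushouts of finite graphs *)

Section Quotient.
Variables (C A : finType) (p q : C -> A).

Definition glue_rel : rel A :=
  fun x y => [exists c, (p c == x) && (q c == y) || (p c == y) && (q c == x)].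

Lemma glue_sym : connect_sym glue_rel.
Proof. by apply: sym_connect_sym => x y; apply: eq_existsb => c; rewrite orbC. Qed.

(** The coequalizer of [p] and [q]: equivalence classes are represented by their [root] elements. *)
Definition glue : finType := {x : A | root glue_rel x == x}.

Lemma glue_proj_subproof x : root glue_rel (root glue_rel x) == root glue_rel x.
Proof. by rewrite (root_root glue_sym). Qed.

Definition glue_proj (x : A) : glue :=
  exist (fun y => root glue_rel y == y) _ (glue_proj_subproof x).

Lemma glue_projK (z : glue) : glue_proj (val z) = z.
Proof. by apply: val_inj; apply/eqP/(valP z). Qed.

Lemma glue_projE c : glue_proj (p c) = glue_proj (q c).
Proof.
apply: val_inj => /=; apply/(rootP glue_sym)/connect1.
by apply/existsP; exists c; rewrite !eqxx.
Qed.

Lemma glue_ind (S : A -> Prop) x y : (forall c, S (p c) <-> S (q c)) ->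
  glue_proj x = glue_proj y -> S x -> S y.
Proof.
move=> hS /(congr1 val)/(rootP glue_sym)/connectP[s hs ->]; elim: s x hs => //= z s IH x.
case/andP=> /existsP[c /orP[] /andP[/eqP h1 /eqP h2]] hs hx; apply: IH hs _.
  by rewrite -h2; apply/hS; rewrite h1.
by rewrite -h1; apply/hS; rewrite h2.
Qed.

Lemma glue_const (T : Type) (f : A -> T) x : (forall c, f (p c) = f (q c)) ->
  f (val (glue_proj x)) = f x.
Proof.
move=> hf; apply: (@glue_ind (fun y => f y = f x) x) => // [c|]; first by rewrite hf.
by rewrite glue_projK.
Qed.

End Quotient.

Section Pushout.
Variables (W X Y : finGraph) (a : hom W X) (b : hom W Y).

Section Construction.
Variables (G : graph) (f : hom X G) (g : hom Y G).
Hypothesis fg : homeq (hcomp f a) (hcomp g b).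

Let pv (w : fvert W) : fvert X + fvert Y := inl (hv a w).
Let qv (w : fvert W) : fvert X + fvert Y := inr (hv b w).
Let pe (w : fedge W) : fedge X + fedge Y := inl (he a w).
Let qe (w : fedge W) : fedge X + fedge Y := inr (he b w).

Let sv (z : fedge X + fedge Y) : fvert X + fvert Y :=
  match z with inl x => inl (fsrc x) | inr y => inr (fsrc y) end.
Let iv (z : fedge X + fedge Y) : fedge X + fedge Y :=
  match z with inl x => inl (finv x) | inr y => inr (finv y) end.

Let po_src (z : glue pe qe) : glue pv qv := glue_proj pv qv (sv (val z)).
Let po_inv (z : glue pe qe) : glue pe qe := glue_proj pe qe (iv (val z)).

Let po_srcE x : po_src (glue_proj pe qe x) = glue_proj pv qv (sv x).
Proof.
rewrite /po_src; apply: (glue_const (f := fun x => glue_proj pv qv (sv x))) => c.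
by have := glue_projE pv qv (fsrc c); rewrite /pv /qv /= -(hom_src a) -(hom_src b).
Qed.

Let po_invE x : po_inv (glue_proj pe qe x) = glue_proj pe qe (iv x).
Proof.
rewrite /po_inv; apply: (glue_const (f := fun x => glue_proj pe qe (iv x))) => c.
by have := glue_projE pe qe (finv c); rewrite /pe /qe /= -(hom_inv a) -(hom_inv b).
Qed.

Let po_invK : involutive po_inv.
Proof.
move=> z; rewrite -[z]glue_projK !po_invE; congr glue_proj.
by case: (val z) => x /=; rewrite finvK.
Qed.

Let fge (z : fedge X + fedge Y) : edge G :=
  match z with inl x => he f x | inr y => he g y end.

(** Gluing alone could identify an edge with its inverse. The cocone [f], [g] into a graph prevents
    this, which is why the construction takes one as a parameter. *)
Let po_inv_neq z : po_inv z <> z.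
Proof.
move=> E; have h c : fge (pe c) = fge (qe c) by case: fg => _ /(_ c).
have := congr1 (fun z => fge (val z)) E.
rewrite -[z]glue_projK po_invE !(glue_const _ h); case: (val z) => x /=.
  by rewrite -(hom_inv f x) => /einv_neq.
by rewrite -(hom_inv g x) => /einv_neq.
Qed.

Definition pushout : finGraph := FinGraph po_src po_invK po_inv_neq.

Definition pushout_inl : hom X pushout :=
  @Hom X pushout (fun x => glue_proj pv qv (inl x)) (fun x => glue_proj pe qe (inl x))
    (fun e => po_srcE (inl e)) (fun e => po_invE (inl e)).
Definition pushout_inr : hom Y pushout :=
  @Hom Y pushout (fun x => glue_proj pv qv (inr x)) (fun x => glue_proj pe qe (inr x))
    (fun e => po_srcE (inr e)) (fun e => po_invE (inr e)).

Lemma pushout_comm : homeq (hcomp pushout_inl a) (hcomp pushout_inr b).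
Proof. by split=> w; [exact: (glue_projE pv qv) | exact: (glue_projE pe qe)]. Qed.

Lemma pushoutP : is_pushout a b pushout_inl pushout_inr.
Proof.
split=> [|G' f' g' fg']; first exact: pushout_comm.
pose kv (z : fvert X + fvert Y) := match z with inl x => hv f' x | inr y => hv g' y end.
pose ke (z : fedge X + fedge Y) := match z with inl x => he f' x | inr y => he g' y end.
have hkv c : kv (pv c) = kv (qv c) by case: fg' => /(_ c).
have hke c : ke (pe c) = ke (qe c) by case: fg' => _ /(_ c).
have ks (e : edge pushout) : src (ke (val e)) = kv (val (@src pushout e)).
  rewrite /= /po_src (glue_const _ hkv).
  by case: (val e) => x /=; [rewrite (hom_src f') | rewrite (hom_src g')].
have ki (e : edge pushout) : einv (ke (val e)) = ke (val (@einv pushout e)).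
  rewrite /= /po_inv (glue_const _ hke).
  by case: (val e) => x /=; [rewrite (hom_inv f') | rewrite (hom_inv g')].
exists (@Hom pushout G' (fun z => kv (val z)) (fun e => ke (val e)) ks ki); split.
  by split; split=> x /=; rewrite ?(glue_const _ hkv) ?(glue_const _ hke).
move=> k' [h1 h2] [h3 h4].
have Ev s : hv k' (glue_proj pv qv s) = kv s
  by case: s => x; [exact: (h1 x) | exact: (h3 x)].
have Ee s : he k' (glue_proj pe qe s) = ke s
  by case: s => x; [exact: (h2 x) | exact: (h4 x)].
by split=> z; [rewrite -[in LHS](glue_projK z) Ev | rewrite -[in LHS](glue_projK z) Ee].
Qed.

End Construction.

Variables (P : finGraph) (a' : hom X P) (b' : hom Y P).
Hypothesis po : is_pushout a b a' b'.

Let Q := pushout po.1.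

Definition sum_vert (z : fvert X + fvert Y) : fvert P :=
  match z with inl x => hv a' x | inr y => hv b' y end.
Definition sum_edge (z : fedge X + fedge Y) : fedge P :=
  match z with inl x => he a' x | inr y => he b' y end.

Let to_Q : exists k : hom P Q, homeq (hcomp k a') (pushout_inl po.1) /\
   homeq (hcomp k b') (pushout_inr po.1).
Proof. by case: (po.2 _ _ _ (pushout_comm po.1)) => k [hk _]; exists k. Qed.

(** The explicit quotient [Q] uses [P] itself as its cocone. The two universal properties give maps
    both ways, and uniqueness for [P] makes [l] a left inverse of [k]; so [P] inherits generation by
    [X] and [Y]. *)
Let retract : exists k l, [/\ homeq (hcomp k a') (pushout_inl po.1),
  homeq (hcomp k b') (pushout_inr po.1),
  homeq (hcomp l (pushout_inl po.1)) a', homeq (hcomp l (pushout_inr po.1)) b' &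
  homeq (hcomp l k) (hid P)].
Proof.
have [k [hk1 hk2]] := to_Q.
have [l [[hl1 hl2] _]] := (pushoutP po.1).2 _ _ _ po.1.
exists k, l; split=> //.
have [j [_ hj]] := po.2 _ _ _ po.1.
have E1 : homeq (hcomp l k) j.
  apply: hj; split=> x.
  - exact: etrans (congr1 (hv l) (hk1.1 x)) (hl1.1 x).
  - exact: etrans (congr1 (he l) (hk1.2 x)) (hl1.2 x).
  - exact: etrans (congr1 (hv l) (hk2.1 x)) (hl2.1 x).
  - exact: etrans (congr1 (he l) (hk2.2 x)) (hl2.2 x).
have E2 : homeq (hid P) j by apply: hj.
by split=> x; [rewrite E1.1 -E2.1 | rewrite E1.2 -E2.2].
Qed.

Lemma po_vert_ex v : exists z, sum_vert z = v.
Proof.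
have [k [l [_ _ h1 h2 h3]]] := retract.
rewrite -[v]h3.1 /= -[hv k v]glue_projK.
by case: (val (hv k v)) => x; [exists (inl x); exact: esym (h1.1 x) |
  exists (inr x); exact: esym (h2.1 x)].
Qed.

Lemma po_edge_ex e : exists z, sum_edge z = e.
Proof.
have [k [l [_ _ h1 h2 h3]]] := retract.
rewrite -[e]h3.2 /= -[he k e]glue_projK.
by case: (val (he k e)) => x; [exists (inl x); exact: esym (h1.2 x) |
  exists (inr x); exact: esym (h2.2 x)].
Qed.

(** Two vertices with the same image in [P] are joined by a chain of vertices of [W]; a property is
    carried along the chain. *)
Lemma po_vert_ind (S : fvert X + fvert Y -> Prop) z z' :
    (forall w, S (inl (hv a w)) <-> S (inr (hv b w))) ->
  sum_vert z = sum_vert z' -> S z -> S z'.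
Proof.
have [k [hk1 hk2]] := to_Q.
move=> hS /(congr1 (hv k)) E; apply: glue_ind hS _; move: E.
have E x : hv k (sum_vert x) = glue_proj (inl \o hv a) (inr \o hv b) x.
  by case: x => x; [exact: (hk1.1 x) | exact: (hk2.1 x)].
by rewrite !E.
Qed.

Lemma po_edge_ind (S : fedge X + fedge Y -> Prop) z z' :
    (forall w, S (inl (he a w)) <-> S (inr (he b w))) ->
  sum_edge z = sum_edge z' -> S z -> S z'.
Proof.
have [k [hk1 hk2]] := to_Q.
move=> hS /(congr1 (he k)) E; apply: glue_ind hS _; move: E.
have E x : he k (sum_edge x) = glue_proj (inl \o he a) (inr \o he b) x.
  by case: x => x; [exact: (hk1.2 x) | exact: (hk2.2 x)].
by rewrite !E.
Qed.

End Pushout.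

(** * Lifting an elementary deformation *)

Lemma hull_vert_mono (G : graph) (L L' : vert G -> Prop) v :
  (forall u, L u -> L' u) -> hull_vert L v -> hull_vert L' v.
Proof. by move=> LL h A B AB hA; apply: h AB _ => u /LL/hA. Qed.

Lemma hull_edge_mono (G : graph) (L L' : vert G -> Prop) e :
  (forall u, L u -> L' u) -> hull_edge L e -> hull_edge L' e.
Proof. by move=> LL h A B AB hA; apply: h AB _ => u /LL/hA. Qed.

Section Induced.
Variables (U : finGraph) (v0 : fvert U) (D : star_tree v0).
Notation T := (stree D).

Section Map.
Variables (Q Q' : finGraph) (f : hom Q U) (f' : hom Q' U) (g : hom Q Q').
Hypothesis fg : homeq (hcomp f' g) f.

Lemma star_leaf_map u t : star_leaf (D := D) f u t -> star_leaf (D := D) f' (hv g u) t.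
Proof.
move=> [a [<- <-]]; exists (he g a); split; first exact: (hom_src g a).
by congr leaf; exact: (fg.2 a).
Qed.

Definition QT_mapv_val (z : fvert Q + fvert Q * fvert T) : fvert Q' + fvert Q' * fvert T :=
  match z with inl u => inl (hv g u) | inr (u, t) => inr (hv g u, t) end.
Definition QT_mape_val (z : fedge Q + fvert Q * fedge T) : fedge Q' + fvert Q' * fedge T :=
  match z with inl a => inl (he g a) | inr (u, b) => inr (hv g u, b) end.

Lemma QT_mapv_subproof (z : QT_vert D f) : QT_vert_ok (D := D) f' (QT_mapv_val (val z)).
Proof.
case: z => -[u|[u t]] /=; have /= -> := fg.1 u => // /andP[-> /asboolP h].
apply/asboolP; exact: (@hull_vert_mono T _ _ _ (@star_leaf_map u) h).
Qed.

Lemma QT_mape_subproof (z : QT_edge D f) : QT_edge_ok (D := D) f' (QT_mape_val (val z)).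
Proof.
case: z => -[a|[u b]] //=; have /= -> := fg.1 u => // /andP[-> /asboolP h].
apply/asboolP; exact: (@hull_edge_mono T _ _ _ (@star_leaf_map u) h).
Qed.

Definition QT_mapv (z : QT_vert D f) : QT_vert D f' :=
  Sub (QT_mapv_val (val z)) (QT_mapv_subproof z).
Definition QT_mape (z : QT_edge D f) : QT_edge D f' :=
  Sub (QT_mape_val (val z)) (QT_mape_subproof z).

Lemma QT_map_src (z : edge (QT D f)) : @src (QT D f') (QT_mape z) = QT_mapv (src z).
Proof.
case: z => -[a|[u b]] h; apply: val_inj => //=.
have /= s := hom_src g a; have /= E := fg.1 (fsrc a); have /= E' := fg.2 a.
by rewrite s E E'; case: ifP.
Qed.

Lemma QT_map_inv (z : edge (QT D f)) : @einv (QT D f') (QT_mape z) = QT_mape (einv z).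
Proof.
case: z => -[a|[u b]] h; apply: val_inj => //=.
by have /= -> := hom_inv g a.
Qed.

Definition QT_map : hom (QT D f) (QT D f') := Hom QT_map_src QT_map_inv.

End Map.

Section ToUT.
Variables (Q : finGraph) (f : hom Q U).

Definition toUT_val (z : fvert Q + fvert Q * fvert T) : fvert U + fvert T :=
  match z with inl u => inl (hv f u) | inr (_, t) => inr t end.

Lemma toUT_subproof (z : QT_vert D f) : UT_vert_ok (D := D) (toUT_val (val z)).
Proof. by case: z => -[u|[u t]]. Qed.

Definition toUTv (z : QT_vert D f) : UT_vert D :=
  Sub (toUT_val (val z)) (toUT_subproof z).
Definition toUTe (z : QT_edge D f) : UT_edge D :=
  match val z with inl a => inl (he f a) | inr (_, b) => inr b end.

Lemma toUT_src (z : edge (QT D f)) : @src (UT D) (toUTe z) = toUTv (src z).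
Proof.
case: z => -[a|[u b]] h; apply: val_inj => //=.
by have /= -> := hom_src f a; case: ifP.
Qed.

Lemma toUT_inv (z : edge (QT D f)) : @einv (UT D) (toUTe z) = toUTe (einv z).
Proof.
case: z => -[a|[u b]] h; rewrite /toUTe //=.
by have /= -> := hom_inv f a.
Qed.

Definition toUT : hom (QT D f) (UT D) := Hom toUT_src toUT_inv.

End ToUT.

Lemma toUT_map (Q Q' : finGraph) (f : hom Q U) (f' : hom Q' U) (g : hom Q Q')
    (gT : hom (QT D f) (QT D f')) :
  homeq (hcomp f' g) f -> induced g gT -> homeq (hcomp (toUT f') gT) (toUT f).
Proof.
move=> fg [h1 h2]; split=> z /=.
  apply: val_inj => /=; rewrite h1; case: z => -[u|[u t]] //= _.
  by congr inl; exact: (fg.1 u).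
rewrite /toUTe h2; case: z => -[a|[u b]] //= _.
by congr inl; exact: (fg.2 a).
Qed.

Lemma induced_to_UTE (Q : finGraph) (f : hom Q U) (g : hom (QT D f) (UT D)) :
  induced_to_UT g -> homeq g (toUT f).
Proof. by move=> [h1 h2]; split=> z; [apply: val_inj; rewrite h1 | rewrite h2]. Qed.

End Induced.

(** The induced maps from [X_T] and [Y_T] to [Z_T] form a cocone. It makes the quotient a graph and,
    by the universal property, also supplies [d_gam]. *)
Lemma deformation_exists (c : config) (v0 : fvert (cU c)) (D : star_tree v0) :
    homeq (hcomp (betaX c) (alphaX c)) (hcomp (betaY c) (alphaY c)) ->
  inhabited (deformation D).
Proof.
move=> comm.
have hX : homeq (hcomp (phiX c) (alphaX c)) (phiW c) by [].
have hY : homeq (hcomp (phiY c) (alphaY c)) (phiW c).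
  by split=> w /=; [have /= <- := comm.1 w | have /= <- := comm.2 w].
have gX : homeq (hcomp (del c) (hcomp (gam c) (betaX c))) (phiX c) by [].
have gY : homeq (hcomp (del c) (hcomp (gam c) (betaY c))) (phiY c) by [].
pose aX := QT_map D hX; pose aY := QT_map D hY.
pose GX := QT_map D gX; pose GY := QT_map D gY.
have cm : homeq (hcomp GX aX) (hcomp GY aY).
  split=> -[[u|[u t]] h]; apply: val_inj => //=.
  - by have /= -> := comm.1 u.
  - by have /= -> := comm.1 u.
  - by have /= -> := comm.2 u.
  - by have /= -> := comm.1 u.
have po := pushoutP cm.
have [k [[hk1 hk2] _]] := po.2 _ _ _ cm.
have gXi : induced (hcomp (gam c) (betaX c)) (hcomp k (pushout_inl cm)).
  by split=> z; [have -> := hk1.1 z | have -> := hk1.2 z].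
have gYi : induced (hcomp (gam c) (betaY c)) (hcomp k (pushout_inr cm)).
  by split=> z; [have -> := hk2.1 z | have -> := hk2.2 z].
by split; apply: (MkDeformation (d_alphaX := aX) (d_alphaY := aY) (d_gam := k)
  (d_del := toUT D (del c)) _ _ po gXi gYi).
Qed.

(** Immersions of graphs in the sense of Stallings. *)
Definition loc_inj (G : finGraph) (G' : graph) (f : hom G G') : Prop :=
  forall e e' : fedge G, fsrc e = fsrc e' -> he f e = he f e' -> e = e'.

Lemma deg_gt1P (G : finGraph) (v : fvert G) :
  reflect (exists e e' : fedge G, [/\ fsrc e = v, fsrc e' = v & e <> e']) (1 < deg v).
Proof.
apply: (iffP card_gt1P) => [[e [e' [h h' /eqP n]]]|[e [e' [h h' n]]]]; exists e, e'.
  by move: h h'; rewrite !inE => /eqP -> /eqP ->.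
by rewrite !inE h h' eqxx; split=> //; apply/eqP.
Qed.

(* These hold for any set [L] of at least two leaves of a finite tree; below they are *)
(* only needed, and proved, for caterpillars. *)
Record hull_spec (T : finGraph) (L : fvert T -> Prop) : Prop := HullSpec {
  hull_connected : connected_subgraph (@hull_vert T L) (@hull_edge T L);
  hull_card : 2 * #|[pred t : fvert T | `[< @hull_vert T L t >]]| =
              #|[pred b : fedge T | `[< @hull_edge T L b >]]| + 2;
  hull_star : forall t : fvert T, @hull_vert T L t ->
    exists b : fedge T, [/\ @hull_edge T L b, fsrc b = t &
      L t \/ exists b' : fedge T, [/\ b' <> b, @hull_edge T L b' & fsrc b' = t]] }.

Definition leaf_hulls (T : finGraph) : Prop := forall L : fvert T -> Prop,
  (forall t, L t -> deg t = 1) -> (exists t t', [/\ L t, L t' & t <> t']) -> hull_spec L.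

Section Lift.
Variables (U : finGraph) (v0 : fvert U) (D : star_tree v0).
Notation T := (stree D).
Variables (Q : finGraph) (f : hom Q U).

Lemma star_leaf_hull (u : fvert Q) : leaf_hulls T -> loc_inj f -> 1 < deg u ->
  (hv f u : fvert U) = v0 -> hull_spec (star_leaf (D := D) f u).
Proof.
move=> hT hf /deg_gt1P[a [a' [h h' n]]] uv.
have src_f (b : fedge Q) : fsrc b = u -> fsrc (he f b : fedge U) = v0.
  by move=> bu; have /= -> := hom_src f b; rewrite bu.
apply: hT => [t [b [bu <-]]|]; first by apply: leaf_deg; apply: src_f.
exists (leaf D (he f a)), (leaf D (he f a')); split; [by exists a | by exists a' |].
move=> E; apply: n; apply: hf; first by rewrite h h'.
by apply: (leaf_inj (s := D)) E; apply: src_f.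
Qed.

Lemma toUT_loc_inj : loc_inj f -> loc_inj (toUT D f).
Proof.
move=> hf [[a|[u b]] h] [[a'|[u' b']] h'] /(congr1 val) /= E.
- move=> [E']; apply: val_inj => /=; congr inl; apply: hf E'.
  by move: E; case: ifP => _; case: ifP => _ // [].
- by [].
- by [].
by case: E => E _ [E']; apply: val_inj; rewrite /= E E'.
Qed.

Lemma QT_deg : leaf_hulls T -> loc_inj f -> (forall u : fvert Q, 1 < deg u) ->
  forall z : fvert (QT D f), 1 < deg z.
Proof.
move=> hT hf hdeg [[u|[u t]] h]; apply/deg_gt1P.
  have [a [a' [hu hu' n]]] := deg_gt1P _ (hdeg u).
  pose A (b : fedge Q) : fedge (QT D f) := exist _ (inl b) isT.
  exists (A a), (A a'); split; last by move=> /(congr1 val) [].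
  - by apply: val_inj; rewrite /= hu (negbTE h).
  - by apply: val_inj; rewrite /= hu' (negbTE h).
have /andP[/eqP uv /asboolP ht] := h.
have [b [hb bt h']] := hull_star (star_leaf_hull hT hf (hdeg u) uv) ht.
have okb (b' : fedge T) : @hull_edge T (star_leaf (D := D) f u) b' ->
    QT_edge_ok (D := D) f (inr (u, b')).
  by move=> hb'; rewrite /= uv eqxx; apply/asboolP.
have eb (b' : fedge T) (hb' : QT_edge_ok (D := D) f (inr (u, b'))) : fsrc b' = t ->
    @fsrc (QT D f) (exist _ (inr (u, b')) hb') = exist _ (inr (u, t)) h.
  by move=> E; apply: val_inj; rewrite /= E.
(* At a leaf of the hull the second edge is the part of [a] outside the star; elsewhere the hull
   itself has two edges. *)
case: h' => [[a [au al]]|[b' [nb hb' bt']]].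
  exists (exist _ (inr (u, b)) (okb _ hb)), (exist _ (inl a) isT); split=> //; first exact: eb.
  by apply: val_inj; rewrite /= au uv eqxx al.
exists (exist _ (inr (u, b)) (okb _ hb)), (exist _ (inr (u, b')) (okb _ hb')); split.
- exact: eb.
- exact: eb.
by move=> /(congr1 val) [] /esym.
Qed.

Lemma card_sum_fin (A B C : finType) (ok : pred (A + B * C)) :
  #|{: {z | ok z}}| = #|[pred x | ok (inl x)]| + \sum_y #|[pred z | ok (inr (y, z))]|.
Proof.
rewrite card_sig -sum1_card big_sumType /= sum1_card; congr (_ + _).
under [RHS]eq_bigr => y _ do rewrite -sum1_card.
by rewrite pair_big_dep; apply: eq_bigl => -[].
Qed.

(** Every edge of [Q] is kept, and each vertex over [v0] is exchanged for a tree, which like a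
    single vertex has one more vertex than nonoriented edges. *)
Lemma QT_rbar : leaf_hulls T -> loc_inj f -> (forall u : fvert Q, 1 < deg u) ->
  rbar (QT D f) = rbar Q.
Proof.
move=> hT hf hdeg.
have eE : #|fedge (QT D f)| = #|fedge Q| + \sum_(u | (hv f u : fvert U) == v0)
    #|[pred b : fedge T | `[< @hull_edge T (star_leaf (D := D) f u) b >]]|.
  apply: etrans (card_sum_fin (QT_edge_ok (D := D) f)) _; congr (_ + _).
  rewrite [RHS]big_mkcond; apply: eq_bigr => u _.
  by case: ifP => h; [apply: eq_card | apply: eq_card0] => b; rewrite !inE /= ?h.
have eV : #|fvert (QT D f)| + #|[pred u : fvert Q | (hv f u : fvert U) == v0]| =
    #|fvert Q| + \sum_(u | (hv f u : fvert U) == v0)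
    #|[pred b : fvert T | `[< @hull_vert T (star_leaf (D := D) f u) b >]]|.
  have -> := card_sum_fin (QT_vert_ok (D := D) f); rewrite /= addnAC.
  rewrite -(cardC [pred u : fvert Q | (hv f u : fvert U) == v0]) [in RHS]addnAC -addnA [in RHS]addnC.
  congr (_ + (_ + _)).
  rewrite [RHS]big_mkcond; apply: eq_bigr => u _.
  by case: ifP => h; [apply: eq_card | apply: eq_card0] => b; rewrite !inE /= ?h.
have eS : 2 * (\sum_(u | (hv f u : fvert U) == v0)
    #|[pred b : fvert T | `[< @hull_vert T (star_leaf (D := D) f u) b >]]|) =
   (\sum_(u | (hv f u : fvert U) == v0)
    #|[pred b : fedge T | `[< @hull_edge T (star_leaf (D := D) f u) b >]]|) +
   2 * #|[pred u : fvert Q | (hv f u : fvert U) == v0]|.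
  rewrite -sum1_card !big_distrr -big_split /=; apply: eq_bigr => u /eqP uv.
  by rewrite muln1; apply/hull_card/star_leaf_hull.
have := rbarE (QT D f); have := rbarE Q; lia.
Qed.

End Lift.

(** * The pushout of the deformed graphs *)

(** After a replacement [phiX] is [betaX] followed by identity maps, so the pushout property has to
    be moved along pointwise equality. *)
Lemma is_pushout_homeq (W X Y P : graph) (a : hom W X) (b : hom W Y)
    (f f' : hom X P) (g g' : hom Y P) :
  homeq f f' -> homeq g g' -> is_pushout a b f g -> is_pushout a b f' g'.
Proof.
move=> ff gg [[cv ce] po]; split.
  by split=> w /=; rewrite -?ff.1 -?ff.2 -?gg.1 -?gg.2; [exact: (cv w) | exact: (ce w)].
move=> G h k hk; have [l [[[l1 l2] [l3 l4]] lu]] := po _ _ _ hk.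
exists l; split.
  by split; split=> x /=; rewrite -?ff.1 -?ff.2 -?gg.1 -?gg.2; [exact: l1 | exact: l2 | exact: l3 | exact: l4].
move=> l' [h1 h2] [h3 h4]; apply: lu; split=> x /=; rewrite ?ff.1 ?ff.2 ?gg.1 ?gg.2;
  [exact: h1 | exact: h2 | exact: h3 | exact: h4].
Qed.

Definition isr (A B : Type) (s : A + B) : bool := if s is inr _ then true else false.

Section Over.
Variables (U : finGraph) (v0 : fvert U) (D : star_tree v0).
Notation T := (stree D).
Variables (PT : finGraph) (pi : hom PT (UT D)).

Definition overv (v : fvert PT) : bool := isr (val (hv pi v : fvert (UT D))).
Definition overe (e : fedge PT) : bool := isr (he pi e : fedge (UT D)).

Lemma overe_src e : overe e -> overv (fsrc e).
Proof.
rewrite /overv /overe; have /= <- := hom_src pi e.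
by case: (he pi e).
Qed.

Lemma overe_inv e : overe (finv e) = overe e.
Proof.
rewrite /overe; have /= <- := hom_inv pi e.
by case: (he pi e).
Qed.

Definition oconn (v w : fvert PT) : Prop :=
  exists p, @walk PT v p w /\ forall e, List.In e p -> overe e.

Lemma oconn_refl v : oconn v v.
Proof. by exists [::]. Qed.

Lemma oconn_trans v w x : oconn v w -> oconn w x -> oconn v x.
Proof.
move=> [p [p1 p2]] [q [q1 q2]]; exists (p ++ q); split; first by apply/walk_cat; exists w.
by move=> e /List.in_app_iff[/p2|/q2].
Qed.

Section Copy.
Variables (Q : finGraph) (f : hom Q U) (fT : hom (QT D f) PT).
Hypothesis fTpi : homeq (hcomp pi fT) (toUT D f).

Definition copy (u : fvert Q) (t : fvert T) (h : QT_vert_ok f (inr (u, t))) : fvert PT :=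
  hv fT (exist _ (inr (u, t)) h : fvert (QT D f)).

Lemma copy_eq (u : fvert Q) (t : fvert T) (h h' : QT_vert_ok f (inr (u, t))) : copy h = copy h'.
Proof. by rewrite (bool_irrelevance h h'). Qed.

Lemma val_pi (z : fvert (QT D f)) : val (hv pi (hv fT z) : fvert (UT D)) = toUT_val f (val z).
Proof. by have /= -> := fTpi.1 z. Qed.

Lemma copy_conn (u : fvert Q) (t t' : fvert T) (h : QT_vert_ok f (inr (u, t)))
    (h' : QT_vert_ok f (inr (u, t'))) :
  hull_spec (star_leaf (D := D) f u) -> oconn (copy h) (copy h').
Proof.
move=> hu; have /andP[/eqP uv /asboolP ht] := h; have /andP[_ /asboolP ht'] := h'.
have [sub /(_ _ _ ht ht') [p [p1 p2]]] := hull_connected hu.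
elim: p t h ht p1 p2 => [|e p IH] t h ht /= p1 p2.
  by move: h; rewrite p1 => h; rewrite (copy_eq h h'); apply: oconn_refl.
case: p1 => se p1; have hte : @hull_edge T (star_leaf (D := D) f u) e by apply: p2; left.
have [_ hi] := sub _ hte; have [ht1 _] := sub _ hi.
have h1 : QT_vert_ok (D := D) f (inr (u, @tgt T e)) by rewrite /= uv eqxx; apply/asboolP.
have h2 : QT_edge_ok (D := D) f (inr (u, e)) by rewrite /= uv eqxx; apply/asboolP.
apply: (@oconn_trans _ (copy h1)); last by apply: IH p1 _ => // e' he'; apply: p2; right.
pose e1 : fedge (QT D f) := exist _ (inr (u, e)) h2.
have s1 : fsrc e1 = exist _ (inr (u, t)) h by apply: val_inj; rewrite /= -se.
have s2 : fsrc (finv e1) = exist _ (inr (u, @tgt T e)) h1 by apply: val_inj.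
exists [:: he fT e1]; split=> /=.
  split; first exact: etrans (hom_src fT e1) (congr1 (hv fT) s1).
  have /= -> := hom_inv fT e1.
  exact: etrans (hom_src fT (finv e1)) (congr1 (hv fT) s2).
by move=> _ [<-|//]; rewrite /overe; have /= -> := fTpi.2 e1.
Qed.

Lemma loc_inj_lift : loc_inj f -> loc_inj fT.
Proof.
move=> hf e e' s E; apply: (toUT_loc_inj hf s).
by have /= <- := fTpi.2 e; have /= <- := fTpi.2 e'; rewrite E.
Qed.

End Copy.
End Over.

Section DeformedPushout.
Variables (U : finGraph) (v0 : fvert U) (D : star_tree v0).
Notation T := (stree D).
Hypothesis TD : leaf_hulls T.
Variables (W X Y : finGraph) (a : hom W X) (b : hom W Y) (f : hom X U) (g : hom Y U) (h : hom W U).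
Hypotheses (po : is_pushout a b f g) (ha : homeq (hcomp f a) h).
Hypotheses (fI : loc_inj f) (gI : loc_inj g) (hI : loc_inj h).
Hypotheses (degX : forall x : fvert X, 1 < deg x) (degY : forall y : fvert Y, 1 < deg y)
  (degW : forall w : fvert W, 1 < deg w).
Variables (PT : finGraph) (aT : hom (QT D h) (QT D f)) (bT : hom (QT D h) (QT D g))
  (fT : hom (QT D f) PT) (gT : hom (QT D g) PT) (pi : hom PT (UT D)).
Hypotheses (poT : is_pushout aT bT fT gT) (aTi : induced a aT) (bTi : induced b bT).
Hypotheses (fTpi : homeq (hcomp pi fT) (toUT D f)) (gTpi : homeq (hcomp pi gT) (toUT D g)).

Let hb : homeq (hcomp g b) h.
Proof. by split=> w; [rewrite -ha.1 po.1.1 | rewrite -ha.2 po.1.2]. Qed.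

(** What remains of an edge of [X] or [Y] outside the stars. In this section [U] is itself the
    pushout of [X] and [Y], as after a replacement. *)
Definition lifte (z : fedge X + fedge Y) : fedge PT :=
  match z with
  | inl x => he fT (exist _ (inl x) isT : fedge (QT D f))
  | inr y => he gT (exist _ (inl y) isT : fedge (QT D g))
  end.

Lemma pi_lifte z : he pi (lifte z) = inl (sum_edge f g z) :> fedge (UT D).
Proof. by case: z => x /=; [have /= -> := fTpi.2 _ | have /= -> := gTpi.2 _]. Qed.

Lemma lifte_ex e : ~~ overe pi e -> exists z, e = lifte z.
Proof.
have [[[[x|[u c]] k]|[[y|[u c]] k]] <-] := po_edge_ex poT e => /=.
- by move=> _; exists (inl x); rewrite /= (bool_irrelevance k isT).
- by rewrite /overe; have /= -> := fTpi.2 (exist _ (inr (u, c)) k).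
- by move=> _; exists (inr y); rewrite /= (bool_irrelevance k isT).
- by rewrite /overe; have /= -> := gTpi.2 (exist _ (inr (u, c)) k).
Qed.

Lemma lifte_eq z z' : sum_edge f g z = sum_edge f g z' -> lifte z = lifte z'.
Proof.
move=> E; apply: (po_edge_ind po (S := fun y => lifte z = lifte y) _ E) => // w.
suff -> : lifte (inl (he a w)) = lifte (inr (he b w)) by [].
pose w' : fedge (QT D h) := exist _ (inl w) isT.
have E1 : he aT w' = exist _ (inl (he a w)) isT by apply: val_inj; rewrite aTi.2.
have E2 : he bT w' = exist _ (inl (he b w)) isT by apply: val_inj; rewrite bTi.2.
by rewrite /lifte -E1 -E2; exact: (poT.1.2 w').
Qed.

(** Outside the trees, the identifications that make [PT] and those that make [U] come from the same
    edges of [W]. *)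
Lemma pi_edge_inj e e' : ~~ overe pi e -> he pi e = he pi e' -> e = e'.
Proof.
move=> h1 E; have h2 : ~~ overe pi e' by rewrite /overe -E.
have [z Ez] := lifte_ex h1; have [z' Ez'] := lifte_ex h2; rewrite Ez Ez'.
by apply: lifte_eq; move: E; rewrite Ez Ez' !pi_lifte => -[].
Qed.

Lemma pi_edge_onto (c : fedge U) : exists2 e, ~~ overe pi e & he pi e = inl c :> fedge (UT D).
Proof.
have [z <-] := po_edge_ex po c; exists (lifte z); last by rewrite pi_lifte.
by rewrite /overe pi_lifte.
Qed.

Lemma pi_vert_inj v v' : ~~ overv pi v -> hv pi v = hv pi v' -> v = v'.
Proof.
move=> h1 E; have h2 : ~~ overv pi v' by rewrite /overv -E.
(* [S v z] says that [z] lies off [v0], hence survives the deformation, and that [v] is its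
   image. *)
pose S v (z : fvert X + fvert Y) := match z with
  | inl x => exists k, hv fT (exist _ (inl x) k : fvert (QT D f)) = v
  | inr y => exists k, hv gT (exist _ (inl y) k : fvert (QT D g)) = v
  end.
have ex w : ~~ overv pi w -> exists2 z, S w z & val (hv pi w : fvert (UT D)) = inl (sum_vert f g z).
  rewrite /overv; have [[[[x|[u c]] k]|[[y|[u c]] k]] <-] := po_vert_ex poT w => /=;
    rewrite ?(val_pi fTpi) ?(val_pi gTpi) //= => _.
  - by exists (inl x); first by exists k.
  - by exists (inr y); first by exists k.
have uniq w w' z : S w z -> S w' z -> w = w'.
  by case: z => z [k <-] [k' <-]; rewrite (bool_irrelevance k k').
have [z Sz Ez] := ex _ h1; have [z' Sz' Ez'] := ex _ h2.
apply: (uniq _ _ z') Sz'.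
have Ezz : sum_vert f g z = sum_vert f g z' by move: Ez; rewrite E Ez' => -[].
apply: (po_vert_ind po _ Ezz) Sz => w.
have E1 : hv f (hv a w) = hv h w by exact: (ha.1 w).
have E2 : hv g (hv b w) = hv h w by exact: (hb.1 w).
have key (k : QT_vert_ok (D := D) h (inl w)) k1 k2 : hv fT (exist _ (inl (hv a w)) k1 : fvert (QT D f)) =
    hv gT (exist _ (inl (hv b w)) k2 : fvert (QT D g)).
  pose w' : fvert (QT D h) := Sub (inl w) k.
  have E3 : hv aT w' = exist _ (inl (hv a w)) k1 by apply: val_inj; rewrite aTi.1.
  have E4 : hv bT w' = exist _ (inl (hv b w)) k2 by apply: val_inj; rewrite bTi.1.
  by rewrite -E3 -E4; exact: (poT.1.1 w').
split=> -[k <-].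
  have k' : QT_vert_ok (D := D) h (inl w) by move: k; rewrite /= E1.
  have k2 : QT_vert_ok (D := D) g (inl (hv b w)) by rewrite /= E2.
  by exists k2; rewrite (key k' k k2).
have k' : QT_vert_ok (D := D) h (inl w) by move: k; rewrite /= E2.
have k1 : QT_vert_ok (D := D) f (inl (hv a w)) by rewrite /= E1.
by exists k1; rewrite (key k' k1 k).
Qed.

Lemma pi_vert_onto (u : fvert U) : u != v0 ->
  exists2 v, ~~ overv pi v & val (hv pi v : fvert (UT D)) = inl u.
Proof.
have [[x|y] <-] := po_vert_ex po u => /= hu.
  exists (hv fT (exist _ (inl x) hu : fvert (QT D f))); rewrite ?/overv (val_pi fTpi) //.
exists (hv gT (exist _ (inl y) hu : fvert (QT D g))); rewrite ?/overv (val_pi gTpi) //.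
Qed.

Lemma hull_copy (Q : finGraph) (k : hom Q U) (q : fvert Q) : loc_inj k -> 1 < deg q ->
  (hv k q : fvert U) = v0 -> exists t, QT_vert_ok (D := D) k (inr (q, t)).
Proof.
move=> kI dq E; have /deg_gt1P[e [_ [eq _ _]]] := dq.
exists (leaf D (he k e)); rewrite /= E eqxx; apply/asboolP => A B _; apply.
by exists e.
Qed.

(** Membership of [v] in the image of the subtree glued in at [z]. *)
Definition is_copy (z : fvert X + fvert Y) (v : fvert PT) : Prop :=
  match z with
  | inl x => exists t (k : QT_vert_ok (D := D) f (inr (x, t))), v = copy fT k
  | inr y => exists t (k : QT_vert_ok (D := D) g (inr (y, t))), v = copy gT k
  end.

Lemma is_copy_over z v : is_copy z v -> sum_vert f g z = v0.
Proof. by case: z => z [t [/andP[/eqP ? _] _]]. Qed.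

Lemma is_copy_ex z : sum_vert f g z = v0 -> exists v, is_copy z v.
Proof.
case: z => z /= E.
  by have [t k] := hull_copy fI (degX z) E; exists (copy fT k), t, k.
by have [t k] := hull_copy gI (degY z) E; exists (copy gT k), t, k.
Qed.

Lemma is_copy_conn z v v' : is_copy z v -> is_copy z v' -> oconn pi v v'.
Proof.
case: z => z [t [k ->]] [t' [k' ->]]; have /andP[/eqP E _] := k.
  by apply: (copy_conn fTpi); apply: star_leaf_hull.
by apply: (copy_conn gTpi); apply: star_leaf_hull.
Qed.

Lemma over_is_copy v : overv pi v -> exists z, is_copy z v.
Proof.
rewrite /overv; have [[[[x|[u t]] k]|[[y|[u t]] k]] <-] := po_vert_ex poT v => /=;
  rewrite ?(val_pi fTpi) ?(val_pi gTpi) //= => _.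
- by exists (inl u), t, k.
- by exists (inr u), t, k.
Qed.

(** The subtrees glued in at the preimages of [v0] are connected. A vertex [w] of [W] over [v0] also
    receives a nonempty subtree, whose image lies in those at [hv a w] and [hv b w], so these two
    meet. *)
Lemma over_oconn v v' : overv pi v -> overv pi v' -> oconn pi v v'.
Proof.
move=> /over_is_copy[z zv] /over_is_copy[z' zv'].
have E : sum_vert f g z = sum_vert f g z' by rewrite (is_copy_over zv) (is_copy_over zv').
pose S z := exists2 w, is_copy z w & oconn pi v w.
suff [w w1 w2] : S z' by apply: oconn_trans w2 (is_copy_conn w1 zv').
have : S z by exists v => //; apply: oconn_refl.
apply: (po_vert_ind po _ E) => w.
have E1 : hv f (hv a w) = hv h w by exact: (ha.1 w).
have E2 : hv g (hv b w) = hv h w by exact: (hb.1 w).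
have key : hv h w = v0 -> exists2 x, is_copy (inl (hv a w)) x & is_copy (inr (hv b w)) x.
  move=> hw; have [t k] := hull_copy hI (degW w) hw.
  pose w' : fvert (QT D h) := exist _ (inr (w, t)) k.
  have k1 : QT_vert_ok (D := D) f (inr (hv a w, t)).
    by have := valP (hv aT w' : fvert (QT D f)); rewrite aTi.1.
  have k2 : QT_vert_ok (D := D) g (inr (hv b w, t)).
    by have := valP (hv bT w' : fvert (QT D g)); rewrite bTi.1.
  have E3 : hv aT w' = exist _ (inr (hv a w, t)) k1 by apply: val_inj; rewrite aTi.1.
  have E4 : hv bT w' = exist _ (inr (hv b w, t)) k2 by apply: val_inj; rewrite bTi.1.
  exists (copy fT k1); first by exists t, k1.
  by exists t, k2; rewrite /copy -E3 -E4; exact: (poT.1.1 w').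
split=> -[x x1 x2].
  have [|y y1 y2] := key; first by rewrite -E1; exact: is_copy_over x1.
  by exists y => //; apply: oconn_trans x2 (is_copy_conn x1 y1).
have [|y y1 y2] := key; first by rewrite -E2; exact: is_copy_over x1.
by exists y => //; apply: oconn_trans x2 (is_copy_conn x1 y2).
Qed.

Definition over_verts : {set fvert PT} := [set v | overv pi v].
Definition over_edges : {set fedge PT} := [set e | overe pi e].

Lemma over_connected :
  @connected_subgraph PT (fun v => v \in over_verts) (fun e => e \in over_edges).
Proof.
split=> [e|v v']; rewrite !inE.
  by move=> he; rewrite overe_inv he overe_src.
move=> h1 h2; have [p [p1 p2]] := over_oconn h1 h2.
by exists p; split=> // e /p2; rewrite inE.
Qed.

Lemma over_verts_ex : exists v, v \in over_verts.
Proof.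
have [z E] := po_vert_ex po v0; have [v hv] := is_copy_ex E.
exists v; rewrite inE; case: z hv {E} => z [t [k ->]]; rewrite /overv /copy.
  by rewrite (val_pi fTpi).
by rewrite (val_pi gTpi).
Qed.

Lemma card_PT_edges : #|fedge PT| = #|fedge U| + #|over_edges|.
Proof.
rewrite -(cardC (mem over_edges)) addnC; congr (_ + _).
rewrite -(card_imset _ (@inl_inj (fedge U) (fedge T))).
have inj : {in predC (mem over_edges) &, injective (he pi : fedge PT -> fedge (UT D))}.
  by move=> e e'; rewrite !inE => h1 _; apply: pi_edge_inj.
rewrite -(card_in_imset inj); apply: eq_card => x; apply/imsetP/imsetP => [[e]|[c _ ->]].
  rewrite !inE /overe => h1 ->; case: (he pi e) h1 => // c _; by exists c.
by have [e h1 h2] := pi_edge_onto c; exists e; rewrite ?inE.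
Qed.

(** The 1 accounts for [v0], the only vertex of [U] that disappears. *)
Lemma card_PT_verts : #|fvert PT| + 1 = #|fvert U| + #|over_verts|.
Proof.
have <- : #|predC (mem over_verts)| + 1 = #|fvert U|.
  rewrite -[RHS](cardC (pred1 v0)) card1 addnC; congr (_ + _).
  have inj : {in predC (mem over_verts) &, injective (fun v => val (hv pi v : fvert (UT D)))}.
    by move=> v v'; rewrite !inE => h1 _ /val_inj; apply: pi_vert_inj.
  rewrite -(card_in_imset inj) -(card_imset _ (@inl_inj (fvert U) (fvert T))).
  apply: eq_card => x; apply/imsetP/imsetP => [[v]|[u]].
    rewrite !inE /overv => + ->; have := valP (hv pi v : fvert (UT D)).
    by case: (val _) => //= u hu _; exists u.
  by rewrite inE => /pi_vert_onto[v h1 h2] ->; exists v; rewrite ?inE.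
have : #|over_verts| + #|predC (mem over_verts)| = #|fvert PT| := cardC (mem over_verts).
lia.
Qed.

Lemma rbar_PT : (rbar PT *+ 2 = rbar U *+ 2 + #|over_edges|%:Z + 2 - (2 * #|over_verts|)%:Z)%R.
Proof. rewrite !rbarE; have := card_PT_verts; have := card_PT_edges; lia. Qed.

Lemma deg_PT_out v u : val (hv pi v : fvert (UT D)) = inl u -> deg v = deg u.
Proof.
move=> E; have hv0 : ~~ overv pi v by rewrite /overv E.
have uv : (u == v0) = false.
  by apply/negbTE; have := valP (hv pi v : fvert (UT D)); rewrite E.
rewrite /deg -(card_imset _ (@inl_inj (fedge U) (fedge T))).
have out e : fsrc e = v -> ~~ overe pi e.
  by move=> se; apply: contra hv0 => /overe_src; rewrite se.
have inj : {in [set e : fedge PT | fsrc e == v] &, injective (he pi : fedge PT -> fedge (UT D))}.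
  by move=> e e'; rewrite !inE => /eqP/out h1 _; apply: pi_edge_inj.
rewrite -(card_in_imset inj); apply: eq_card => x; apply/imsetP/imsetP => [[e]|[c]].
  rewrite inE => /eqP se ->; have := out _ se; rewrite /overe.
  have := congr1 val (hom_src pi e); rewrite /= se E.
  case: (he pi e) => //= c; case: ifP => // _ [cu] _.
  by exists c; rewrite ?inE ?cu.
rewrite inE => /eqP cu ->; have [e h1 h2] := pi_edge_onto c.
exists e => //; rewrite inE; apply/eqP/esym/pi_vert_inj => //; apply: val_inj.
have /= <- := hom_src pi e; rewrite E; have -> : he pi e = inl c by [].
by rewrite /= cu uv.
Qed.

(** The edges issuing from the part over [T] either stay in it or are what remains of the edges in
    the star of [v0], one for each. *)
Lemma sum_deg_over : \sum_(v in over_verts) deg v = #|over_edges| + deg v0.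
Proof.
rewrite (sum_deg_in (mem over_verts)) -(cardsID over_edges); congr (_ + _).
  apply: eq_card => e; rewrite !inE andbC; case: (boolP (overe pi e)) => //= /overe_src ->.
  by [].
rewrite /deg -(card_imset (star v0) (@inl_inj (fedge U) (fedge T))).
have inj : {in [set e : fedge PT | fsrc e \in over_verts] :\: over_edges &,
     injective (he pi : fedge PT -> fedge (UT D))}.
  by move=> e e'; rewrite !inE => /andP[h1 _] _; apply: pi_edge_inj.
rewrite -(card_in_imset inj); apply: eq_card => x; apply/imsetP/imsetP => [[e]|[c]].
  rewrite !inE /overe /overv => /andP[+ +] ->; have /= <- := hom_src pi e.
  case: (he pi e) => //= c; case: ifP => // /eqP cu _ _.
  by exists c; rewrite ?inE ?cu.
rewrite inE => /eqP cu ->; have [e h1 h2] := pi_edge_onto c.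
exists e => //; rewrite !inE h1 /overv; have /= <- := hom_src pi e.
by have -> : he pi e = inl c by []; rewrite /= cu eqxx.
Qed.

Lemma deg_PT (v : fvert PT) : 1 < deg v.
Proof.
have hf := QT_deg TD fI degX; have hg := QT_deg TD gI degY.
have up (Q : finGraph) (k : hom Q PT) z : loc_inj k -> 1 < deg z -> 1 < deg (hv k z : fvert PT).
  move=> kI /deg_gt1P[e [e' [h1 h2 n]]]; apply/deg_gt1P; exists (he k e), (he k e'); split.
  - by have /= -> := hom_src k e; rewrite h1.
  - by have /= -> := hom_src k e'; rewrite h2.
  - by move=> E; apply: n; apply: kI => //; rewrite h1.
have [[z|z] <-] := po_vert_ex poT v.
  by apply: up (hf z); apply: (loc_inj_lift fTpi).
by apply: up (hg z); apply: (loc_inj_lift gTpi).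
Qed.

Lemma excess_PT (v1 v2 : fvert PT) : 2 * #|over_verts| = #|over_edges| + 2 ->
    v1 \in over_verts -> v2 \in over_verts -> v1 != v2 -> 2 < deg v1 -> 2 < deg v2 ->
  excess PT < excess U.
Proof.
move=> card2 h1 h2 n12 d1 d2.
have out : \sum_(v | v \notin over_verts) (deg v - 3) = \sum_(u | u != v0) (deg u - 3).
  (* The inverse of [pi] off [v0]; [v1] is only a default, reached for [u = v0]. *)
  pose F u := if [pick v | val (hv pi v : fvert (UT D)) == inl u] is Some v then v else v1.
  have FE u : u != v0 -> val (hv pi (F u) : fvert (UT D)) = inl u.
    move=> /pi_vert_onto[v hv1 hv2]; rewrite /F; case: pickP => [w /eqP //|/(_ v)].
    by rewrite hv2 eqxx.
  pose toU v := if val (hv pi v : fvert (UT D)) is inl u then u else v0.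
  have toUE v u : val (hv pi v : fvert (UT D)) = inl u -> toU v = u by rewrite /toU => ->.
  rewrite (reindex_onto toU F); last by move=> u /FE/toUE.
  apply: eq_big => [v|v]; rewrite inE /overv.
    have := valP (hv pi v : fvert (UT D)).
    case E: (val _) => [u|t] //= hu; last by rewrite /toU E eqxx.
    rewrite (toUE _ _ E) hu /=.
    apply/esym/eqP/esym/pi_vert_inj; first by rewrite /overv E.
    by apply: val_inj; rewrite FE.
  by case E: (val _) => [u|t] // _; rewrite (deg_PT_out E) (toUE _ _ E).
rewrite /excess (bigID (mem over_verts)) /= out addnC [X in _ < X](bigD1 v0) //= addnC ltn_add2r.
have sum2 : \sum_(v in over_verts) (deg v - 2) + 2 = deg v0.
  have := sum_deg_over; rewrite (eq_bigr (fun v => (deg v - 2) + 2)) => [|v _]; last first.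
    by have := deg_PT v; lia.
  rewrite big_split /= sum_nat_const; lia.
(* Both [v1] and [v2] have degree at least 3, so each loses exactly 1 when 2 is replaced by 3. With
   [sum2] the excess over [T] is at most deg v0 - 4. *)
have sum3 : \sum_(v in over_verts) (deg v - 3) + 2 <= \sum_(v in over_verts) (deg v - 2).
  rewrite (bigD1 v1) //= (bigD1 v2) /=; last by rewrite h2 eq_sym.
  rewrite [X in _ <= X](bigD1 v1) //= [X in _ <= _ + X](bigD1 v2) /=; last by rewrite h2 eq_sym.
  have : \sum_(i | ((i \in over_verts) && (i != v1)) && (i != v2)) (deg i - 3) <=
         \sum_(i | ((i \in over_verts) && (i != v1)) && (i != v2)) (deg i - 2).
    by apply: leq_sum => i _; lia.
  move: d1 d2; lia.
lia.
Qed.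

Lemma deformed_alternative (v1 v2 : fvert PT) :
    v1 \in over_verts -> v2 \in over_verts -> v1 != v2 -> 2 < deg v1 -> 2 < deg v2 ->
  (rbar U < rbar PT)%R \/
  [/\ rbar PT = rbar U,
      @tree_subgraph PT (fun v => v \in over_verts) (fun e => e \in over_edges) &
      excess PT < excess U].
Proof.
move=> h1 h2 n12 d1 d2; have [r hr] := over_verts_ex.
have := connected_card hr over_connected; rewrite leq_eqVlt => /orP[/eqP E|lt].
  right; split; first by have := rbar_PT; lia.
  - exact: connected_card_tree hr over_connected E.
  - exact: excess_PT E h1 h2 n12 d1 d2.
by left; have := rbar_PT; lia.
Qed.

End DeformedPushout.

(** * Choice of the tree *)

Section LeafSets.
Variable n : nat.
Hypothesis n0 : 0 < n.
Notation cat := (caterpillar n).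

Lemma cat_leaf_set (L : cat_vert n -> Prop) : (forall t, L t -> @deg cat t = 1) ->
  forall v, L v <-> exists2 i, i \in [set i | `[< L (cat_leaf i) >]] & cat_leaf i = v.
Proof.
move=> Ld v; split=> [Lv|[i + <-]]; last by rewrite inE => /asboolP.
have E : v = cat_leaf (val v).1 by have := Ld _ Lv; rewrite cat_deg //; case: eqP.
by exists (val v).1; [rewrite inE; apply/asboolP; move: Lv; rewrite {1}E | exact: esym E].
Qed.

Lemma cat_leaf_hulls : leaf_hulls cat.
Proof.
move=> L Ld [t [t' [Lt Lt' ntt]]].
have LE := cat_leaf_set Ld; set I := [set i | _] in LE.
have cI : 1 < #|I|.
  have [i iI it] := (LE _).1 Lt; have [j jI jt] := (LE _).1 Lt'.
  apply/card_gt1P; exists i, j; split=> //; apply/eqP => ij.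
  by apply: ntt; rewrite -it -jt ij.
have hV : @hull_vert cat L = (fun v => cat_hullv I v).
  by apply: funext => v; rewrite propeqE; exact: cat_hull_vertE.
have hE : @hull_edge cat L = (fun e => cat_hulle I e).
  by apply: funext => v; rewrite propeqE; exact: cat_hull_edgeE.
split.
- by rewrite hV hE; exact: cat_hull_connected.
- have I0 : I != set0 by rewrite -card_gt0; apply: leq_trans cI.
  rewrite hV hE; have := cat_hull_card I0.
  rewrite -[X in 2 * X](@eq_card _ [pred t | `[< cat_hullv I t >]]) => [|v]; last first.
    by rewrite !inE asboolb.
  by rewrite -[X in X + 2](@eq_card _ [pred t | `[< cat_hulle I t >]]) => [|v]; rewrite ?inE ?asboolb.
by move=> v; rewrite hV hE; exact: (cat_hull_star cI LE).
Qed.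

End LeafSets.

(** The list consists of the elements of [Lo], then [c] and [d] next to each other, then all the
    others. *)
Lemma separating_order (E : finType) (S Lo : {set E}) (c d : E) :
    c \in S -> d \in S -> c \notin Lo -> d \notin Lo -> c != d ->
  exists s : seq E, [/\ uniq s, s =i S,
    forall x, x \in S -> x \in Lo -> index x s < index c s,
    index c s < index d s &
    forall x, x \in S -> x \notin Lo -> x != c -> x != d -> index d s < index x s].
Proof.
move=> cS dS cL dL cd.
pose P := enum (S :&: Lo); pose R := enum (S :\: Lo :\ c :\ d).
have mP x : (x \in P) = (x \in S) && (x \in Lo) by rewrite mem_enum inE.
have mR x : (x \in R) = [&& x != d, x != c, x \notin Lo & x \in S] by rewrite mem_enum !inE.
have ic : index c (P ++ [:: c, d & R]) = size P.
  by rewrite index_cat mP (negbTE cL) andbF /= eqxx addn0.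
have id : index d (P ++ [:: c, d & R]) = (size P).+1.
  by rewrite index_cat mP (negbTE dL) andbF /= (negbTE cd) eqxx addn1.
exists (P ++ [:: c, d & R]); split.
- rewrite cat_uniq /= !enum_uniq !inE !mR !mP !eqxx (negbTE cL) (negbTE dL) (negbTE cd).
  rewrite !andbF /= !andbT; apply/hasPn => x; rewrite mR mP; case/and4P => _ _ /negbTE -> _.
  by rewrite andbF.
- move=> x; rewrite mem_cat !inE mP mR.
  case: (eqVneq x c) => [->|xc]; first by rewrite cS orbT.
  case: (eqVneq x d) => [->|xd]; first by rewrite dS orbT.
  by case: (x \in Lo); rewrite ?andbT ?andbF ?orbF.
- by move=> x xS xL; rewrite ic index_cat mP xS xL index_mem mP xS xL.
- by rewrite ic id.
move=> x xS xL xc xd; rewrite id index_cat mP (negbTE xL) andbF /=.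
by rewrite eq_sym (negbTE xc) eq_sym (negbTE xd) !addnS ltnS ltnS leq_addr.
Qed.

(* Placing the middle elements [c] and [d] of two distinct triples next to each other *)
(* gives the triples distinct middles. *)
Lemma order_two_triples (E : finType) (S A A' : {set E}) :
    A \subset S -> A' \subset S -> #|A| = 3 -> #|A'| = 3 -> A != A' ->
  exists s : seq E, [/\ uniq s, s =i S & exists c d, [/\ c \in A, d \in A', c != d,
    exists a b, [/\ a \in A, b \in A & index a s < index c s < index b s] &
    exists a b, [/\ a \in A', b \in A' & index a s < index d s < index b s]]].
Proof.
move=> AS AS' c3 c3' nA.
have ex (B B' : {set E}) : #|B| = 3 -> #|B'| = 3 -> B != B' -> exists2 c, c \in B & c \notin B'.
  move=> h h' nB; have : ~~ (B \subset B').
    by apply: contra nB => sB; rewrite eqEcard sB h h'.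
  by case/subsetPn => c; exists c.
have [c cA cA'] := ex _ _ c3 c3' nA; have [|d dA' dA] := ex _ _ c3' c3; first by rewrite eq_sym.
have cd : c != d by apply: contraNneq cA' => ->.
have c2 : 1 < #|A :\ c| by rewrite (cardsD1 c A) cA in c3; rewrite -ltnS -[_.+1]c3.
have c2' : 1 < #|A' :\ d| by rewrite (cardsD1 d A') dA' in c3'; rewrite -ltnS -[_.+1]c3'.
(* [c] and [d] become the middles as soon as [Lo] contains one, but not the other, of two further
   elements of each triple. *)
have [Lo [cL dL]] : exists Lo : {set E}, [/\ c \notin Lo, d \notin Lo,
    exists a b, [/\ a \in A :\ c, b \in A :\ c, a \in Lo & b \notin Lo] &
    exists a b, [/\ a \in A' :\ d, b \in A' :\ d, a \in Lo & b \notin Lo]].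
  have [x [y [xA yA xy]]] := card_gt1P c2; have [x' [y' [xA' yA' xy']]] := card_gt1P c2'.
  case: (boolP [disjoint A :\ c & A' :\ d]) => [dis|].
    exists [set x; x']; split.
    - rewrite !inE; apply/norP; split; first by move: xA; rewrite !inE eq_sym => /andP[].
      by apply: contraNneq cA' => ->; move: xA'; rewrite inE => /andP[].
    - rewrite !inE; apply/norP; split; last by move: xA'; rewrite !inE eq_sym => /andP[].
      by apply: contraNneq dA => ->; move: xA; rewrite inE => /andP[].
    - exists x, y; split=> //; rewrite !inE ?eqxx // [y == x]eq_sym (negbTE xy) /=.
      by apply/negP=> /eqP E'; have := disjointFr dis yA; rewrite E' xA'.
    - exists x', y'; split=> //; rewrite !inE ?eqxx ?orbT // [y' == x']eq_sym (negbTE xy') orbF.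
      by apply/negP=> /eqP E'; have := disjointFl dis yA'; rewrite E' xA.
  (* A common element [z] can serve as the low element of both triples. *)
  case/pred0Pn => z /andP[/= zA zA'].
  have other (B : {set E}) : 1 < #|B| -> exists2 b, b \in B & b \notin [set z].
    move=> /card_gt1P[u [v [uB vB uv]]]; case: (eqVneq u z) => [uz|nz].
      by exists v; rewrite // inE -uz eq_sym.
    by exists u; rewrite // inE.
  exists [set z]; split.
  - by rewrite inE eq_sym; move: zA; rewrite !inE => /andP[].
  - by rewrite inE eq_sym; move: zA'; rewrite !inE => /andP[].
  - by have [b h1 h2] := other _ c2; exists z, b; split=> //; rewrite inE.
  - by have [b h1 h2] := other _ c2'; exists z, b; split=> //; rewrite inE.
move=> [a [b [aA bA aL bL]]] [a' [b' [aA' bA' aL' bL']]].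
move: aA bA aA' bA'; rewrite !inE => /andP[ac aA] /andP[bc bA] /andP[ad aA'] /andP[bd bA'].
have cS := subsetP AS _ cA; have dS := subsetP AS' _ dA'.
have [s [us sS h1 h2 h3]] := separating_order cS dS cL dL cd.
exists s; split=> //; exists c, d; split=> //.
  exists a, b; split=> //; rewrite h1 // ?(subsetP AS) //=.
  apply: ltn_trans h2 (h3 _ (subsetP AS _ bA) bL bc _).
  by apply: contraNneq dA => <-.
exists a', b'; split=> //; rewrite (ltn_trans (h1 _ (subsetP AS' _ aA') aL') h2) /=.
apply: h3 => //; first exact: (subsetP AS').
by apply: contraNneq cA' => <-.
Qed.

(** Quantified over all larger sets [L] of leaves, since the star of a preimage may contain more
    edges than the triple [A]. *)
Definition branches (U : finGraph) (v0 : fvert U) (D : star_tree v0) (A : {set fedge U})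
    (t : fvert (stree D)) : Prop :=
  forall L : fvert (stree D) -> Prop, (forall s, L s -> deg s = 1) ->
    (forall e, e \in A -> L (leaf D e)) ->
  exists e1 e2 e3 : fedge (stree D), [/\ [/\ e1 <> e2, e1 <> e3 & e2 <> e3],
    [/\ @hull_edge (stree D) L e1, @hull_edge (stree D) L e2 & @hull_edge (stree D) L e3] &
    [/\ fsrc e1 = t, fsrc e2 = t & fsrc e3 = t]].

Lemma star_tree_exists (U : finGraph) (v0 : fvert U) (A A' : {set fedge U}) :
    3 < deg v0 -> A \subset star v0 -> A' \subset star v0 -> #|A| = 3 -> #|A'| = 3 -> A != A' ->
  exists D : star_tree v0, [/\ forall t : fvert (stree D), deg t = 1 \/ deg t = 3,
    leaf_hulls (stree D) &
    exists t1 t2, [/\ t1 <> t2, branches A t1 & @branches _ _ D A' t2]].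
Proof.
move=> d4 AS AS' c3 c3' nA.
have [s [us sS [c [d [cA dA' cd [a [b [aA bA acb]]] [a' [b' [aA' bA' adb]]]]]]]] :=
  order_two_triples AS AS' c3 c3' nA.
(* The caterpillar has n + 1 leaves, one for each ray; rays are assigned to leaves by their position
   in [s]. *)
pose n := (deg v0).-1.
have n0 : 0 < n by rewrite /n; lia.
have sn : size s = n.+1.
  by rewrite /n prednK ?(ltn_trans _ d4) // deg_star -(eq_card sS) (card_uniqP us).
pose idx e : 'I_n.+1 := inord (index e s).
have idxE e : e \in star v0 -> idx e = index e s :> nat.
  by rewrite -sS -index_mem sn /idx => h; rewrite inordK.
have idx_inj e e' : e \in star v0 -> e' \in star v0 -> idx e = idx e' -> e = e'.
  move=> h h' /(congr1 (@nat_of_ord _)); rewrite !idxE // => E.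
  by apply: (index_inj e _ _ E); rewrite sS.
have onto (i : 'I_n.+1) : exists2 e, e \in star v0 & idx e = i.
  have [e0 _] : exists e0 : fedge U, e0 \in star v0 by apply/card_gt0P; rewrite -deg_star; lia.
  exists (nth e0 s i); first by rewrite -sS mem_nth // sn.
  by apply: val_inj; rewrite /= idxE ?index_uniq ?sn // -sS mem_nth // sn.
have l1 e : fsrc e = v0 -> @deg (caterpillar n) (cat_leaf (idx e)) = 1.
  by move=> _; rewrite cat_deg // eqxx.
have l2 e e' : fsrc e = v0 -> fsrc e' = v0 -> cat_leaf (idx e) = cat_leaf (idx e') -> e = e'.
  by move=> h h' /cat_leaf_inj; apply: idx_inj; rewrite inE ?h ?h'.
have l3 t : @deg (caterpillar n) t = 1 -> exists e, fsrc e = v0 /\ cat_leaf (idx e) = t.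
  rewrite cat_deg //; case: eqP => // -> _; have [e h1 h2] := onto (val t).1.
  by exists e; rewrite h2; split=> //; move: h1; rewrite inE => /eqP.
pose D := @StarTree U v0 (caterpillar n) (cat_tree n) (fun e => cat_leaf (idx e)) l1 l2 l3.
have br (B : {set fedge U}) x y z : B \subset star v0 -> x \in B -> y \in B -> z \in B ->
    index x s < index y s < index z s -> @branches U v0 D B (spine (idx y)).
  move=> BS xB yB zB xyz L Ld LB; have LE := cat_leaf_set n0 Ld; set I := [set i | _] in LE.
  have inI e : e \in B -> idx e \in I by move=> eB; rewrite inE; apply/asboolP/LB.
  have xyz' : idx x < idx y < idx z by rewrite !idxE ?(subsetP BS).
  have [e1 [e2 [e3 [h1 [h2 h3 h4] h5]]]] := cat_hull_branch (inI _ xB) (inI _ yB) (inI _ zB) xyz'.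
  have cI : 1 < #|I|.
    apply/card_gt1P; exists (idx x), (idx y); split; rewrite ?inI //.
    by rewrite -val_eqE neq_ltn; case/andP: xyz' => ->.
  have hE e := (cat_hull_edgeE cI LE e).
  by exists e1, e2, e3; split=> //; split; apply/hE.
exists D; split.
- by move=> t; rewrite cat_deg //; case: ifP; [left | right].
- exact: cat_leaf_hulls.
exists (spine (idx c)), (spine (idx d)); split.
- move=> /(congr1 val) [] /(congr1 val) /=; rewrite -!/(idx _).
  move=> E; move/eqP: cd; apply; apply: idx_inj; [exact: (subsetP AS) | exact: (subsetP AS') |].
  exact: val_inj.
- exact: br AS aA cA bA acb.
exact: br AS' aA' dA' bA' adb.
Qed.

(** * Stars of the pushout *)

Lemma loc_inj_comp (G : finGraph) (G' G'' : graph) (k : hom G' G'') (l : hom G G') (m : hom G G'') :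
  homeq (hcomp k l) m -> loc_inj m -> loc_inj l.
Proof. by move=> klm mI e e' s E; apply: mI => //; rewrite -!klm.2 /= E. Qed.

Lemma deg_loc_inj (G G' : finGraph) (k : hom G G') (v : fvert G) :
  loc_inj k -> deg v <= deg (hv k v : fvert G').
Proof.
move=> kI; rewrite /deg; have inj : {in [set e | fsrc e == v] &, injective (he k : fedge G -> fedge G')}.
  by move=> e e'; rewrite !inE => /eqP h /eqP h'; apply: kI; rewrite h h'.
rewrite -(card_in_imset inj); apply/subset_leq_card/subsetP => x /imsetP[e].
by rewrite !inE => /eqP h ->; have /= -> := hom_src k e; rewrite h.
Qed.

Lemma rbar_sum_deg (G : finGraph) : (forall v : fvert G, 1 < deg v) ->
  (rbar G *+ 2 = (\sum_(v : fvert G) (deg v - 2))%:Z)%R.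
Proof.
move=> hG; rewrite rbarE -sum_deg (eq_bigr (fun v => (deg v - 2) + 2)) => [|v _]; last first.
  by have := hG v; lia.
have E : \sum_(v : fvert G) 2 = 2 * #|fvert G| by rewrite -sum1_card big_distrr.
by rewrite big_split /= E PoszD GRing.addrK.
Qed.

(** The loop invariant. It concerns only the graphs and maps that a replacement keeps, so it holds
    for [replacement c] as well. *)
Record good (c : config) : Prop := Good {
  good_pushout : is_pushout (alphaX c) (alphaY c) (betaX c) (betaY c);
  good_alphaX : loc_inj (alphaX c);
  good_alphaY : loc_inj (alphaY c);
  good_betaX : loc_inj (betaX c);
  good_betaY : loc_inj (betaY c);
  good_degX : forall x : fvert (cX c), 1 < deg x;
  good_degY : forall y : fvert (cY c), 1 < deg y;
  good_degW : forall w : fvert (cW c), 1 < deg w }.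

Lemma core_deg (G : finGraph) (G' : graph) (f : hom G G') :
  onto_core f -> forall v : fvert G, 1 < deg v.
Proof.
move=> [[fv fe] [hv he]] v; apply/deg_gt1P.
have [|e1 [e2 [c1 c2 s1 s2 n12]]] := @core_vert_edges _ (Defs.hv f v); first by apply/hv; exists v.
have [x1 E1] := (he _).1 c1; have [x2 E2] := (he _).1 c2.
exists x1, x2; split.
- by apply: fv; have /= <- := hom_src f x1; rewrite E1.
- by apply: fv; have /= <- := hom_src f x2; rewrite E2.
- by move=> E; apply: n12; rewrite -E1 -E2 E.
Qed.

(** Edges lift uniquely to a covering once the initial vertex is given, and [i] is injective on
    edges. *)
Lemma covering_loc_inj (U : graph) (u0 : vert U) (H : seq (edge U) -> Prop) (C : covering u0 H)
    (G : finGraph) (i : hom G (cov_graph C)) (f : hom G U) :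
  embedding i -> homeq f (hcomp (cov_map C) i) -> loc_inj f.
Proof.
move=> [iv ie] fi e e' s E; apply: ie.
have [|x [_ hx]] := @cov_local _ _ _ C (hv i (fsrc e)) (he f e).
  by have /= -> := hom_src f e; exact: fi.1.
have <- : x = he i e by apply: hx; split; [exact: (hom_src i e) | exact: esym (fi.2 e)].
by apply: hx; split; [rewrite s; exact: (hom_src i e') | rewrite E; exact: esym (fi.2 e')].
Qed.

Lemma associated_good (c : config) u0 H K S1 : associated c u0 H K S1 -> good c.
Proof.
case=> covH covK covL incX incY incZ coreX coreY _ pX pY _
  incW [ew ee] incWv incWe aX aY po _ _ _ _ _ _ _ _.
have fI : loc_inj (phiX c) by apply: covering_loc_inj pX; case: coreX.
have gI : loc_inj (phiY c) by apply: covering_loc_inj pY; case: coreY.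
(* If two pullback edges share the source and one component, their other components have the same
   source and the same image in [U], so local injectivity identifies them. *)
have pbE (e e' : fedge (pullback (phiX c) (phiY c))) : fsrc e = fsrc e' ->
    (val e).1 = (val e').1 \/ (val e).2 = (val e').2 -> e = e'.
  move=> /(congr1 val) [s1 s2]; case: e e' s1 s2 => -[x y] /= xy [[x' y'] /= xy'] s1 s2 E.
  have [Ex Ey] : x = x' /\ y = y'.
    case: E => E; split=> //.
      apply: gI => //.
      exact: etrans (esym (eqP xy)) (etrans (congr1 (he (phiX c)) E) (eqP xy')).
    apply: fI => //.
    exact: etrans (eqP xy) (etrans (congr1 (he (phiY c)) E) (esym (eqP xy'))).
  by apply: val_inj; rewrite /= Ex Ey.
have src_w (e e' : fedge (cW c)) : fsrc e = fsrc e' ->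
    fsrc (he incW e : fedge (pullback (phiX c) (phiY c))) = fsrc (he incW e').
  by move=> s; have /= -> := hom_src incW e; have /= -> := hom_src incW e'; rewrite s.
split=> //.
- move=> e e' s E; apply: ee; apply: pbE (src_w _ _ s) _; left.
  by have /= <- := aX.2 e; have /= <- := aX.2 e'.
- move=> e e' s E; apply: ee; apply: pbE (src_w _ _ s) _; right.
  by have /= <- := aY.2 e; have /= <- := aY.2 e'.
- exact: (@loc_inj_comp _ _ _ (phiP c) _ _ _ fI).
- exact: (@loc_inj_comp _ _ _ (phiP c) _ _ _ gI).
- exact: core_deg coreX.
- exact: core_deg coreY.
(* A pullback edge is labelled by its source, so both core edges found at a vertex of [W] belong to
   [W]. *)
move=> w; apply/deg_gt1P; have [cw [t [St lt]]] := (incWv _).1 (ex_intro _ w erefl).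
have [e1 [e2 [c1 c2 s1 s2 n12]]] := core_vert_edges cw.
have [|x1 E1] := (incWe e1).2; first by split=> //; exists t; split=> //; have /= -> := s1.
have [|x2 E2] := (incWe e2).2; first by split=> //; exists t; split=> //; have /= -> := s2.
exists x1, x2; split.
- by apply: ew; have /= <- := hom_src incW x1; rewrite E1.
- by apply: ew; have /= <- := hom_src incW x2; rewrite E2.
- by move=> E; apply: n12; rewrite -E1 -E2 E.
Qed.

Section Stars.
Variables (W X Y P : finGraph) (a : hom W X) (b : hom W Y) (f : hom X P) (g : hom Y P).
Hypothesis po : is_pushout a b f g.
Hypotheses (aI : loc_inj a) (fI : loc_inj f) (gI : loc_inj g).
Hypotheses (degX : forall x : fvert X, 1 < deg x) (degY : forall y : fvert Y, 1 < deg y)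
  (degW : forall w : fvert W, 1 < deg w).
Implicit Types (z : fvert X + fvert Y) (v : fvert P).

Definition sum_deg_at z : nat := match z with inl x => deg x | inr y => deg y end.

Definition sum_star z : {set fedge P} :=
  match z with
  | inl x => [set he f e | e in star x]
  | inr y => [set he g e | e in star y]
  end.

Lemma card_sum_star z : #|sum_star z| = sum_deg_at z.
Proof.
case: z => z /=; rewrite deg_star card_in_imset // => e e'; rewrite !inE => /eqP h /eqP h'.
  by apply: fI; rewrite h h'.
by apply: gI; rewrite h h'.
Qed.

Lemma sum_star_sub z : sum_star z \subset star (sum_vert f g z).
Proof.
apply/subsetP=> x; case: z => z /imsetP[e]; rewrite !inE => /eqP <- ->.
  by have /= -> := hom_src f e.
by have /= -> := hom_src g e.
Qed.

(* Two preimages joined by a vertex of [W] share at least two edges of the star, so a *)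
(* preimage of degree 2 has the same star as its neighbours. *)
Lemma star_closure v (M : {set fedge P}) z0 : sum_vert f g z0 = v -> sum_star z0 \subset M ->
    (forall z, sum_vert f g z = v -> sum_deg_at z <= 2 \/ sum_star z \subset M) ->
  star v \subset M.
Proof.
move=> z0v z0M hM.
have all z : sum_vert f g z = v -> sum_star z \subset M.
  move=> zv; pose S z := sum_vert f g z = v -> sum_star z \subset M.
  suff : S z by apply.
  have Sz0 : S z0 := fun _ => z0M.
  apply: (po_vert_ind po _ (etrans z0v (esym zv)) Sz0) => w.
  have E : sum_vert f g (inl (hv a w)) = sum_vert f g (inr (hv b w)) by exact: (po.1.1 w).
  pose B : {set fedge P} := [set he f (he a e) | e in star w].
  have cB : 1 < #|B|.
    rewrite card_in_imset -?deg_star // => e e'; rewrite !inE => /eqP h /eqP h' EE.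
    have s : fsrc (he a e) = fsrc (he a e').
      by have /= -> := hom_src a e; have /= -> := hom_src a e'; rewrite h h'.
    by apply: aI (fI s EE); rewrite h h'.
  have Ba : B \subset sum_star (inl (hv a w)).
    apply/subsetP=> _ /imsetP[e + ->]; rewrite inE => /eqP h; apply: imset_f; rewrite inE.
    by have /= -> := hom_src a e; rewrite h.
  have Bb : B \subset sum_star (inr (hv b w)).
    apply/subsetP=> _ /imsetP[e + ->]; rewrite inE => /eqP h; have /= -> := po.1.2 e.
    by apply: imset_f; rewrite inE; have /= -> := hom_src b e; rewrite h.
  have step z1 z2 : B \subset sum_star z1 -> B \subset sum_star z2 ->
      sum_star z1 \subset M -> sum_vert f g z2 = v -> sum_star z2 \subset M.
    move=> B1 B2 M1 z2v; case: (hM _ z2v) => // le2.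
    suff <- : B = sum_star z2 by apply: subset_trans M1.
    by apply/eqP; rewrite eqEcard B2 card_sum_star (leq_trans le2).
  split=> h vz; first exact: step Ba Bb (h (etrans E vz)) vz.
  exact: step Bb Ba (h (etrans (esym E) vz)) vz.
apply/subsetP=> e; rewrite inE => /eqP ev.
have [[x|y] ex] := po_edge_ex po e.
  apply: (subsetP (all (inl (fsrc x)) _)).
    by have /= <- := hom_src f x; rewrite -ev -ex.
  by rewrite -ex; apply: imset_f; rewrite inE.
apply: (subsetP (all (inr (fsrc y)) _)).
  by have /= <- := hom_src g y; rewrite -ev -ex.
by rewrite -ex; apply: imset_f; rewrite inE.
Qed.

(** If all preimages had degree at most 2, [star_closure] with the star of a single preimage as [M]
    would bound deg v by 2. *)
Lemma big_preimage v : 2 < deg v -> exists2 z, sum_vert f g z = v & 2 < sum_deg_at z.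
Proof.
move=> d2; have [z0 E0] := po_vert_ex po v.
case: (pselect (exists2 z, sum_vert f g z = v & 2 < sum_deg_at z)) => // no.
have le z : sum_vert f g z = v -> sum_deg_at z <= 2.
  by move=> zv; rewrite leqNgt; apply/negP => h; apply: no; exists z.
have /subset_leq_card := star_closure E0 (subxx _) (fun z zv => or_introl (le z zv)).
by rewrite card_sum_star -deg_star => h; have := le _ E0; lia.
Qed.

Lemma triple_in (B : {set fedge P}) u : 2 < #|B| -> u \in B ->
  exists A : {set fedge P}, [/\ A \subset B, #|A| = 3 & u \in A].
Proof.
move=> B2 uB; have /card_gt1P[x [y [xB yB xy]]] : 1 < #|B :\ u|.
  by rewrite (cardsD1 u B) uB in B2.
exists (u |: [set x; y]); move: xB yB; rewrite !in_setD1 => /andP[xu xB] /andP[yu yB]; split.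
- by apply/subsetP => t; rewrite !inE => /orP[/eqP -> //|/orP[] /eqP ->].
- by rewrite cardsU1 cards2 xy !inE negb_or ![u == _]eq_sym xu yu.
- by rewrite !inE eqxx.
Qed.

(** Take a triple [A] in a star of more than two edges. If all such stars were contained in [A],
    [star_closure] would give deg v <= 3; so one has an edge outside [A], and a triple through that
    edge differs from [A]. *)
Lemma two_triples v : 3 < deg v -> exists z z' (A A' : {set fedge P}),
  [/\ sum_vert f g z = v, sum_vert f g z' = v, A \subset sum_star z, A' \subset sum_star z' &
      [/\ #|A| = 3, #|A'| = 3 & A != A']].
Proof.
move=> d3; have [z zv z2] := big_preimage (ltnW d3).
have [u uz] : exists u, u \in sum_star z by apply/card_gt0P; rewrite card_sum_star; lia.
rewrite -card_sum_star in z2; have [A [Az A3 uA]] := triple_in z2 uz.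
case: (pselect (exists z', [/\ sum_vert f g z' = v, 2 < #|sum_star z'| & ~~ (sum_star z' \subset A)])).
  move=> [z' [zv' z2' /subsetPn[u' uz' uA']]]; have [A' [Az' A3' uA'']] := triple_in z2' uz'.
  exists z, z', A, A'; split=> //; split=> //.
  by apply: contraNneq uA' => ->.
move=> no; have hA z' : sum_vert f g z' = v -> sum_deg_at z' <= 2 \/ sum_star z' \subset A.
  move=> zv'; case: (leqP (sum_deg_at z') 2) => h; [by left | right].
  by apply/negPn/negP => n; apply: no; exists z'; rewrite card_sum_star.
have zA : sum_star z \subset A.
  by case: (hA _ zv) => //; rewrite -card_sum_star; lia.
have /subset_leq_card := star_closure zv zA hA.
by rewrite A3 -deg_star; lia.
Qed.

Lemma deg_P v : 1 < deg v.
Proof.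
have [[x|y] <-] := po_vert_ex po v.
  exact: leq_trans (degX x) (deg_loc_inj x fI).
exact: leq_trans (degY y) (deg_loc_inj y gI).
Qed.

Lemma deg_bound v : deg v - 2 <= \sum_(z | sum_vert f g z == v) 3 * (sum_deg_at z - 2).
Proof.
case: (leqP (deg v) 2) => [h|d2]; first by rewrite (eqP h).
have [z0 z0v d0] := big_preimage d2.
pose big z := (sum_vert f g z == v) && (2 < sum_deg_at z).
pose M := \bigcup_(z | big z) sum_star z.
have big_sub z : big z -> sum_star z \subset M by move=> h; apply: (bigcup_sup z).
have z0M : sum_star z0 \subset M by apply: big_sub; rewrite /big z0v eqxx.
have sM : star v \subset M.
  apply: star_closure z0v z0M _ => z zv; case: (leqP (sum_deg_at z) 2) => h; [by left | right].
  by apply: big_sub; rewrite /big zv eqxx.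
have le : #|M| <= \sum_(z | big z) sum_deg_at z.
  rewrite /M; elim/big_rec2: _ => [|z n B _ h]; first by rewrite cards0.
  by rewrite (leq_trans (leq_card_setU _ _)) // card_sum_star leq_add2l.
apply: leq_trans (leq_subr _ _) _; rewrite deg_star.
apply: leq_trans (subset_leq_card sM) (leq_trans le _).
rewrite [X in X <= _]big_mkcondr; apply: leq_sum => z _.
(* Here d <= 3 (d - 2) is used for d > 2. *)
by case: ifP => //; lia.
Qed.

Lemma rbar_bound : (rbar P <= (rbar X + rbar Y) *+ 3)%R.
Proof.
have := rbar_sum_deg degX; have := rbar_sum_deg degY; have := rbar_sum_deg deg_P.
suff : \sum_(v : fvert P) (deg v - 2) <=
    3 * (\sum_(x : fvert X) (deg x - 2) + \sum_(y : fvert Y) (deg y - 2)) by lia.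
apply: leq_trans (leq_sum _ (fun v _ => deg_bound v)) _.
have -> : \sum_(x : fvert X) (deg x - 2) + \sum_(y : fvert Y) (deg y - 2) =
    \sum_z (sum_deg_at z - 2) by rewrite big_sumType.
rewrite big_distrr /= [X in _ <= X](partition_big (sum_vert f g) predT) //=.
Qed.

End Stars.

(** * Termination *)

Lemma deform (c : config) (v0 : fvert (cP c)) : good c -> 3 < deg v0 ->
  exists c', [/\ admissible_deformation (replacement c) c', good c',
    [/\ rbar (cX c') = rbar (cX c), rbar (cY c') = rbar (cY c) & rbar (cW c') = rbar (cW c)] &
    (rbar (cP c) < rbar (cP c'))%R \/
      rbar (cP c') = rbar (cP c) /\ excess (cP c') < excess (cP c)].
Proof.
case: c v0 => X Y W P Z0 U0 a b f g gm dl v0 /= [/= po aI bI fI gI degX degY degW] d3.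
pose c1 := Config a b f g (hid P) (hid P).
have [z [z' [A [A' [zv zv' Az Az' [c3 c3' nA]]]]]] := two_triples po aI fI gI degW d3.
have AS : A \subset star v0 by rewrite -zv; apply: subset_trans Az (sum_star_sub _ _ _).
have AS' : A' \subset star v0 by rewrite -zv'; apply: subset_trans Az' (sum_star_sub _ _ _).
have [D [D3 hD [t1 [t2 [t12 br1 br2]]]]] := star_tree_exists d3 AS AS' c3 c3' nA.
have [d] := @deformation_exists c1 v0 D po.1.
have po1 : is_pushout a b (phiX c1) (phiY c1) by apply: is_pushout_homeq po.
have FI : loc_inj (phiX c1) by exact: fI.
have GI : loc_inj (phiY c1) by exact: gI.
have HI : loc_inj (phiW c1).
  move=> e e' s /fI E; apply: aI => //; apply: E.
  by have /= -> := hom_src a e; have /= -> := hom_src a e'; rewrite s.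
have ha : homeq (hcomp (phiX c1) a) (phiW c1) by [].
have hb : homeq (hcomp (phiY c1) b) (phiW c1).
  by split=> w /=; [have /= <- := po.1.1 w | have /= <- := po.1.2 w].
pose pi : hom (dP d) (UT D) := hcomp (d_del d) (d_gam d).
have del_to := induced_to_UTE (d_del_ind d).
have piX : homeq (hcomp pi (d_betaX d)) (toUT D (phiX c1)).
  have h : homeq (hcomp (del c1) (hcomp (gam c1) f)) (phiX c1) by [].
  have [h1 h2] := toUT_map h (d_gamX_ind d).
  by split=> x; [rewrite -h1; exact: (del_to.1 _) | rewrite -h2; exact: (del_to.2 _)].
have piY : homeq (hcomp pi (d_betaY d)) (toUT D (phiY c1)).
  have h : homeq (hcomp (del c1) (hcomp (gam c1) g)) (phiY c1) by [].
  have [h1 h2] := toUT_map h (d_gamY_ind d).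
  by split=> x; [rewrite -h1; exact: (del_to.1 _) | rewrite -h2; exact: (del_to.2 _)].
have gd : good (deformed d).
  split=> /=.
  - exact: d_pushout.
  - exact: loc_inj_comp (toUT_map ha (d_alphaX_ind d)) (toUT_loc_inj HI).
  - exact: loc_inj_comp (toUT_map hb (d_alphaY_ind d)) (toUT_loc_inj HI).
  - exact: loc_inj_comp piX (toUT_loc_inj FI).
  - exact: loc_inj_comp piY (toUT_loc_inj GI).
  - exact: QT_deg hD FI degX.
  - exact: QT_deg hD GI degY.
  - exact: QT_deg hD HI degW.
(* The subtree at [q] has three edges at the branch point [t] of the triple, and local injectivity
   of [kT] keeps them distinct in the pushout. *)
have branch_lift (Q : finGraph) (k : hom Q P) (kT : hom (QT D k) (dP d)) (q : fvert Q)
    (B : {set fedge P}) t :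
    loc_inj k -> homeq (hcomp pi kT) (toUT D k) -> hv k q = v0 ->
    B \subset [set he k e | e in star q] -> branches B t ->
  exists v : fvert (dP d), [/\ v \in over_verts pi, 2 < deg v & val (hv pi v : fvert (UT D)) = inr t].
  move=> kI kTpi qv Bq brB.
  have Ld s : star_leaf (D := D) k q s -> deg s = 1.
    by move=> [e [eq <-]]; apply: leaf_deg; have /= -> := hom_src k e; rewrite eq.
  have LB e : e \in B -> star_leaf (D := D) k q (leaf D e).
    by move=> /(subsetP Bq)/imsetP[e' + ->]; rewrite inE => /eqP h; exists e'.
  have [e1 [e2 [e3 [[n12 n13 n23] [h1 h2 h3] [s1 s2 s3]]]]] := brB _ Ld LB.
  have okv : QT_vert_ok (D := D) k (inr (q, t)).
    rewrite /= qv eqxx; apply/asboolP => A0 B0 AB LA; rewrite -s1.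
    by case: (AB) => [/(_ _ (h1 _ _ AB LA)) []].
  have oke e : @hull_edge (stree D) (star_leaf (D := D) k q) e -> QT_edge_ok (D := D) k (inr (q, e)).
    by move=> he; rewrite /= qv eqxx; apply/asboolP.
  pose x : fvert (QT D k) := Sub (inr (q, t)) okv.
  pose E e (h : @hull_edge (stree D) (star_leaf (D := D) k q) e) : fedge (QT D k) :=
    Sub (inr (q, e)) (oke _ h).
  exists (hv kT x); rewrite inE /overv (val_pi kTpi); split=> //.
  apply: leq_trans (deg_loc_inj x (loc_inj_comp kTpi (toUT_loc_inj kI))).
  apply/card_gt2P; exists (E _ h1), (E _ h2), (E _ h3); split; rewrite ?inE.
  - by split; apply/eqP/val_inj; rewrite /= ?s1 ?s2 ?s3.
  - by split; rewrite -val_eqE /=; apply/eqP => -[] //; exact: nesym.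
have lift (y : fvert X + fvert Y) (B : {set fedge P}) t : sum_vert f g y = v0 -> B \subset sum_star f g y ->
    branches B t ->
  exists v : fvert (dP d), [/\ v \in over_verts pi, 2 < deg v & val (hv pi v : fvert (UT D)) = inr t].
  case: y => y yv By brB.
    exact: (branch_lift _ (phiX c1) (d_betaX d) y B t FI piX yv By brB).
  exact: (branch_lift _ (phiY c1) (d_betaY d) y B t GI piY yv By brB).
have [v1 [v1o v1d v1t]] := lift _ _ _ zv Az br1.
have [v2 [v2o v2d v2t]] := lift _ _ _ zv' Az' br2.
(* The two vertices cannot have been glued together, since they lie over different vertices of
   [T]. *)
have v12 : v1 != v2 by apply/eqP => E; apply: t12; move: v1t; rewrite E v2t => -[].
have alt := deformed_alternative hD po1 ha FI GI HI degX degY degW (d_pushout d) (d_alphaX_ind d)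
  (d_alphaY_ind d) piX piY v1o v2o v12 v1d v2d.
exists (deformed d); split=> //.
- split; first by split; split; exists id.
  exists v0, D, d; split=> //; case: alt => [?|[E tr ex]]; [by left | right; split=> //].
  have -> : over_tree_vert (d := d) = (fun v => v \in over_verts pi).
    apply: funext => v; rewrite propeqE inE /over_tree_vert /overv /pi /=.
    by case: (val _) => x /=; split=> //; by [case | move=> _; exists x].
  have -> // : over_tree_edge (d := d) = (fun e => e \in over_edges pi).
  apply: funext => e; rewrite propeqE inE /over_tree_edge /overe /pi /=.
  by case: (he _ _) => x /=; split=> //; by [case | move=> _; exists x].
- by split; apply: QT_rbar.
by case: alt => [?|[E _ ex]]; [left | right].
Qed.

(** The initial replacement is kept outside [tau], so that a round, a deformation followed by a
    replacement, can be put in front of the sequence obtained by induction. *)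
Lemma deform_iterate (c : config) : good c ->
  exists (tau : seq operation) (c' : config), [/\ alternating (Replacement :: tau),
    run tau (replacement c) c',
    [/\ rbar (cX c') = rbar (cX c), rbar (cY c') = rbar (cY c) & rbar (cW c') = rbar (cW c)] &
    [/\ PZU c', (rbar (cP c) <= rbar (cP c'))%R,
       forall u : fvert (cU c'), deg u = 3 \/ deg u = 2 &
       forall u : fvert (cU c'), deg u = 3 ->
      (exists x : fvert (cX c'), hv (phiX c') x = u /\ deg x = 3) \/
      (exists y : fvert (cY c'), hv (phiY c') y = u /\ deg y = 3)]].
Proof.
have bound c1 : good c1 -> (rbar (cP c1) <= (rbar (cX c1) + rbar (cY c1)) *+ 3)%R.
  by case=> po aI bI fI gI degX degY degW; apply: rbar_bound po aI fI gI degX degY degW.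
(* Lexicographic induction: [k] measures how far rbar(P) is below its bound, and for fixed [k] the
   inner induction is on the excess. *)
have [k] : exists k : nat, ((rbar (cX c) + rbar (cY c)) *+ 3 - rbar (cP c) < k%:Z)%R.
  by exists (absz ((rbar (cX c) + rbar (cY c)) *+ 3 - rbar (cP c))%R).+1; lia.
elim: k c => [|k IHk] c; first by move=> h /bound; lia.
have [m] := ubnP (excess (cP c)); elim: m c => // m IHm c hm hk gc.
case: (pselect (exists v : fvert (cP c), 3 < deg v)) => [[v dv]|no]; last first.
  have d3 (v : fvert (cP c)) : deg v <= 3.
    by rewrite leqNgt; apply/negP => h; apply: no; exists v.
  case: (gc) => po aI bI fI gI degX degY degW.
  exists [::], (replacement c); split=> //; split=> //=.
  - by split; split; exists id.
  - by move=> u; have := d3 u; have := deg_P po fI gI degX degY u; lia.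
  move=> u du; have [|z zu dz] := big_preimage po aI fI gI degW (v := u); first by rewrite du.
  (* The star of [z] has more than two edges and embeds in a star of three. *)
  have dz3 : sum_deg_at z = 3.
    have := subset_leq_card (sum_star_sub (betaX c) (betaY c) z).
    by rewrite card_sum_star // zu -deg_star du; lia.
  by case: z zu dz3 {dz} => z zu dz; [left | right]; exists z.
have [c' [adm gc' [rX rY rW] alt]] := deform gc dv.
have [tau [c'' [h1 h2 [r1 r2 r3] [h3 h4 h5 h6]]]] : exists tau c'', [/\ alternating (Replacement :: tau),
    run tau (replacement c') c'',
    [/\ rbar (cX c'') = rbar (cX c'), rbar (cY c'') = rbar (cY c') & rbar (cW c'') = rbar (cW c')] &
    [/\ PZU c'', (rbar (cP c') <= rbar (cP c''))%R,
       forall u : fvert (cU c''), deg u = 3 \/ deg u = 2 &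
       forall u : fvert (cU c''), deg u = 3 ->
      (exists x : fvert (cX c''), hv (phiX c'') x = u /\ deg x = 3) \/
      (exists y : fvert (cY c''), hv (phiY c'') y = u /\ deg y = 3)]].
  (* A gain in rbar(P) lowers [k], whatever happens to the excess; otherwise rbar(P) is unchanged
     and the excess drops. *)
  case: alt => [lt|[E lt]]; first by apply: IHk => //; rewrite rX rY; lia.
  by apply: IHm => //; [lia | rewrite rX rY E].
exists (AdmissibleDeformation :: Replacement :: tau), c''; split=> //.
- by exists c'; split=> //; exists (replacement c').
- by rewrite r1 r2 r3.
by split=> //; case: alt => [lt|[E _]]; lia.
Qed.

Theorem lemma3p5 (c : config) (u0 : fvert (cU c))
    (H K S S1 : seq (fedge (cU c)) -> Prop)
    (U_connected : connected (cU c))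
    (U_deg : forall v : fvert (cU c), deg v <> 1)
    (H_fg : @fg_subgroup (cU c) u0 H)
    (K_fg : @fg_subgroup (cU c) u0 K)
    (S_reps : @dcoset_reps (cU c) u0 H K S)
    (S1_sub : forall t, S1 t -> S t)
    (S1_neq0 : exists t, S1 t)
    (c_assoc : associated c u0 H K S1) :
  exists (tau : seq operation) (c' : config),
    alternating tau /\ run tau c c' /\
    rbar (cX c') = rbar (cX c) /\
    rbar (cY c') = rbar (cY c) /\
    rbar (cW c') = rbar (cW c) /\
    PZU c' /\
    (rbar (cP c) <= rbar (cP c'))%R /\
    (forall u : fvert (cU c'), deg u = 3 \/ deg u = 2) /\
    (forall u : fvert (cU c'), deg u = 3 ->
      (exists x : fvert (cX c'), hv (phiX c') x = u /\ deg x = 3) \/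
      (exists y : fvert (cY c'), hv (phiY c') y = u /\ deg y = 3)).
Proof.
have [tau [c' [h1 h2 [r1 r2 r3] [h3 h4 h5 h6]]]] := deform_iterate (associated_good c_assoc).
exists (Replacement :: tau), c'; do !split=> //.
by exists (replacement c).
Qed.
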